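(* Let $\varepsilon>0$, $\alpha\ge0$ and let $\beta$ be a (penalization) constant. The $L^2$-gradient flow of the (variant of the) Esedoglu–Rätz–Röger energy $$\mathcal{W}_\varepsilon^{\mathrm{ERR}}(u)=\frac{1}{2\varepsilon}\int_\Omega\left(\varepsilon\Delta u-\frac{W'(u)}{\varepsilon}\right)^2dx+\beta\,\frac{1}{\varepsilon^{1+\alpha}}\int_\Omega\left(\varepsilon\nabla^2u:\mathbb{N}(u)-\frac{W'(u)}{\varepsilon}\right)^2dx,\qquad \mathbb{N}(u)=\frac{\nabla u}{|\nabla u|}\otimes\frac{\nabla u}{|\nabla u|},$$ is equivalent to the system $$\begin{cases}\varepsilon^2\partial_tu=\Delta\mu-\frac{1}{\varepsilon^2}W''(u)\mu-\beta\widetilde{L}(u),\\[2pt] \mu=W'(u)-\varepsilon^2\Delta u,\\[2pt] \xi_\varepsilon=\varepsilon\nabla^2u:\mathbb{N}(u)-\frac{W'(u)}{\varepsilon},\\[2pt] \widetilde{L}(u)=2\varepsilon^{1-\alpha}\left[\left(\mathbb{N}(u):\nabla^2\xi_\varepsilon-\frac{1}{\varepsilon^2}W''(u)\xi_\varepsilon\right)+2\left(\operatorname{div}\left(\frac{\nabla u}{|\nabla u|}\right)\frac{\nabla u}{|\nabla u|}\right)\cdot\nabla\xi_\varepsilon+\mathcal{B}(u)\xi_\varepsilon\right],\\[2pt] \mathcal{B}(u)=\operatorname{div}\left(\operatorname{div}\left(\frac{\nabla u}{|\nabla u|}\right)\frac{\nabla u}{|\nabla u|}\right)-\operatorname{div}\left(\nabla\left(\frac{\nabla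 u}{|\nabla u|}\right)\frac{\nabla u}{|\nabla u|}\right).\end{cases}$$
   Context: $\Omega\subset\mathbb{R}^N$ is open, bounded, with Lipschitz boundary, and $W(s)=\frac12s^2(1-s)^2$ is the double-well potential. $\nabla^2u$ is the Hessian of $u$, $A:B=\sum_{i,j}A_{ij}B_{ij}$, $(a\otimes b)_{ij}=a_ib_j$, and for a vector field $\nu$, $\nabla\nu$ is the matrix with entries $(\nabla\nu)_{ij}=\partial_j\nu_i$, so $(\nabla\nu)\nu$ is the derivative of $\nu$ in the direction $\nu$. The $L^2$-gradient of an energy $F$ at $u$ is the function $\nabla F(u)$ such that $\lim_{s\to0}\frac{F(u+sw)-F(u)}{s}=\int_\Omega\nabla F(u)\,w\,dx$ for all $w\in C_c^\infty(\Omega)$. Here $u$ is smooth and $\nabla u\neq0$, so that the expressions involving $\nabla u/|\nabla u|$ make sense. The phrase ''the $L^2$-gradient flow of $F$ is equivalent to an evolution system'' means that, after the constant rescaling of time by the factor $\varepsilon$, the gradient flow of $F$, i.e. $\partial_tu=-\frac1\varepsilon\nabla F(u)$, is exactly the stated system (with the auxiliary quantities eliminated through their defining equations). *)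

(* Defs.v *)
From HB Require Import structures.
From mathcomp Require Import all_boot all_order all_algebra.
From mathcomp Require Import all_classical all_reals all_analysis.

Set Implicit Arguments.
Unset Strict Implicit.
Unset Printing Implicit Defensive.
Import Order.TTheory GRing.Theory Num.Theory.
Import numFieldNormedType.Exports.

Local Open Scope classical_set_scope.
Local Open Scope ring_scope.

(* The library has no Lebesgue measure on R^n. Row vectors get the sigma-algebra
   generated by the coordinates (as the library does for tuples), which is the
   Borel one, and the measure is the iterated product of the 1-d one. *)
Definition row_display : measure_display.
Proof. exact: default_measure_display. Qed.

Section row_measurable.
Context {R : realType} (n : nat).

Definition row_coord (i : 'I_n) (x : 'rV[R]_n) : measurableTypeR R := x 0 i.

Let row_set0 : g_sigma_preimage row_coord set0.
Proof. exact: sigma_algebra0. Qed.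

Let row_setC A : g_sigma_preimage row_coord A -> g_sigma_preimage row_coord (~` A).
Proof. exact: sigma_algebraC. Qed.

Let row_bigcup (F : _^nat) : (forall i, g_sigma_preimage row_coord (F i)) ->
  g_sigma_preimage row_coord (\bigcup_i (F i)).
Proof. exact: sigma_algebra_bigcup. Qed.

HB.instance Definition _ := @isMeasurable.Build row_display
  'rV[R]_n (g_sigma_preimage row_coord) row_set0 row_setC row_bigcup.

End row_measurable.

Section row_lebesgue.
Context {R : realType}.

Lemma measurable_row_coord n (i : 'I_n) :
  measurable_fun [set: 'rV[R]_n] (row_coord i).
Proof.
move=> _ Y mY; rewrite setTI; apply: sub_sigma_algebra => /=.
rewrite -bigcup_seq/=; exists i => /=; first by rewrite mem_index_enum.
by exists Y => //; rewrite setTI.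
Qed.

Lemma measurable_fun_row d (T : measurableType d) n (f : T -> 'rV[R]_n) :
  (forall i, measurable_fun [set: T] (row_coord i \o f)) ->
  measurable_fun [set: T] f.
Proof.
move=> mf _ A mA; rewrite setTI.
suff: [set B | measurable (f @^-1` B)] A by [].
apply: mA; split.
  split.
  - by rewrite /= preimage_set0.
  - by move=> B /= mB; rewrite setTD preimage_setC; exact: measurableC.
  - by move=> F /= mF; rewrite preimage_bigcup; exact: bigcup_measurable.
rewrite -bigcup_seq => B [i _ [C mC <-]]; rewrite setTI /= -comp_preimage.
by rewrite -[X in measurable X]setTI; exact: mf.
Qed.

Definition row_cons n (p : measurableTypeR R * 'rV[R]_n) : 'rV[R]_n.+1 :=
  row_mx (p.1%:M : 'rV[R]_1) p.2.

Definition row_uncons n (x : 'rV[R]_n.+1) : measurableTypeR R * 'rV[R]_n :=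
  (x 0 0, \row_j x 0 (lift 0 j)).

Lemma row_cons0 n (p : measurableTypeR R * 'rV[R]_n) : row_cons p 0 0 = p.1.
Proof.
have -> : (0 : 'I_n.+1) = lshift n (0 : 'I_1) by apply: val_inj.
by rewrite /row_cons (row_mxEl (p.1%:M : 'rV[R]_1)) mxE eqxx.
Qed.

Lemma row_consS n (p : measurableTypeR R * 'rV[R]_n) j :
  row_cons p 0 (lift 0 j) = p.2 0 j.
Proof.
have -> : (lift 0 j : 'I_n.+1) = rshift 1 j by apply: val_inj.
by rewrite /row_cons (row_mxEr (p.1%:M : 'rV[R]_1)).
Qed.

Lemma row_consK n : cancel (@row_cons n) (@row_uncons n).
Proof.
move=> [a x]; rewrite /row_uncons row_cons0; congr pair.
by apply/rowP => j; rewrite mxE row_consS.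
Qed.

Lemma measurable_row_cons n : measurable_fun setT (@row_cons n).
Proof.
apply: measurable_fun_row => i; have [j ->|->] := unliftP 0 i; last first.
  rewrite (_ : _ \o _ = fst); first exact: measurable_fst.
  by apply/funext => p; rewrite /= /row_coord row_cons0.
rewrite (_ : _ \o _ = row_coord j \o snd).
  by apply: measurableT_comp; [exact: measurable_row_coord|exact: measurable_snd].
by apply/funext => p; rewrite /= /row_coord row_consS.
Qed.

Lemma measurable_row_uncons n : measurable_fun setT (@row_uncons n).
Proof.
apply: measurable_fun_pair; first exact: (measurable_row_coord 0).
apply: measurable_fun_row => i.
rewrite (_ : _ \o _ = row_coord (lift 0 i)); first exact: measurable_row_coord.
by apply/funext => x; rewrite /= /row_coord mxE.
Qed.

Section step.
Variables (n : nat) (mu : {sigma_finite_measure set 'rV[R]_n -> \bar R}).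

Definition lebesgue_step : set 'rV[R]_n.+1 -> \bar R :=
  pushforward (lebesgue_measure \x mu)%E (@row_cons n).

Let lebesgue_step0 : lebesgue_step set0 = 0%E.
Proof. by rewrite /lebesgue_step /pushforward preimage_set0 measure0. Qed.

Let lebesgue_step_ge0 A : (0 <= lebesgue_step A)%E.
Proof. by rewrite /lebesgue_step /pushforward. Qed.

Let lebesgue_step_sigma_additive : semi_sigma_additive lebesgue_step.
Proof.
move=> F mF tF mUF; rewrite /lebesgue_step /pushforward preimage_bigcup.
have mpre B : measurable B -> measurable (@row_cons n @^-1` B).
  by move=> mB; rewrite -[X in measurable X]setTI; exact: measurable_row_cons.
apply: measure_semi_sigma_additive.
- by move=> k; exact: mpre.
- apply/trivIsetP => /= i j _ _ ij; rewrite -preimage_setI.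
  by move/trivIsetP : tF => /(_ _ _ _ _ ij) ->//; rewrite preimage_set0.
- by rewrite -preimage_bigcup; exact: mpre.
Qed.

HB.instance Definition _ := isMeasure.Build _ _ _ lebesgue_step
  lebesgue_step0 lebesgue_step_ge0 lebesgue_step_sigma_additive.

Let lebesgue_step_sigma_finite : sigma_finite setT lebesgue_step.
Proof.
have [F [FT ndF Foo]] : exists F : (set (measurableTypeR R))^nat, [/\ setT = \bigcup_k F k,
    nondecreasing_seq F & forall k, measurable (F k) /\ (lebesgue_measure (F k) < +oo)%E].
  exact/sigma_finiteP/sigma_finiteT.
have /sigma_finiteP[G [GT ndG Goo]] := sigma_finiteT mu.
exists (fun k => @row_uncons n @^-1` (F k `*` G k)).
  apply/esym; rewrite -subTset => x _.
  have [i _ Fi] : (\bigcup_k F k) (row_uncons x).1 by rewrite -FT.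
  have [j _ Gj] : (\bigcup_k G k) (row_uncons x).2 by rewrite -GT.
  exists (maxn i j) => //; split.
  - by move: Fi; exact/subsetPset/ndF/leq_maxl.
  - by move: Gj; exact/subsetPset/ndG/leq_maxr.
move=> k; have [mF Fk] := Foo k; have [mG Gk] := Goo k; split.
  by rewrite -[X in measurable X]setTI; apply: measurable_row_uncons => //; exact: measurableX.
rewrite /lebesgue_step /pushforward -comp_preimage.
rewrite (_ : _ \o _ = id); last by apply/funext/row_consK.
by rewrite preimage_id product_measure1E// lte_mul_pinfty// ge0_fin_numE.
Qed.

HB.instance Definition _ := Measure_isSigmaFinite.Build _ _ _ lebesgue_step
  lebesgue_step_sigma_finite.

End step.

Fixpoint lebesgue_row n : {sigma_finite_measure set 'rV[R]_n -> \bar R} :=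
  match n with
  | 0 => \d_(0 : 'rV[R]_0)
  | m.+1 => lebesgue_step (lebesgue_row m)
  end.

Lemma lebesgue_row_box n (A : 'I_n -> set R) :
  (forall i, measurable (A i : set (measurableTypeR R))) ->
  lebesgue_row n [set x | forall i, A i (x 0 i)] =
    (\prod_(i < n) lebesgue_measure (A i))%E.
Proof.
elim: n A => [A _|n IH A mA].
  rewrite big_ord0 /= diracE; congr (_%:E); rewrite mem_set//.
  by move=> [].
rewrite big_ord_recl -IH//= /lebesgue_step /pushforward.
rewrite -product_measure1E//.
  congr (_ _); apply/seteqP; split => -[a x] /=.
    move=> H; split; first by have := H 0; rewrite row_cons0.
    by move=> i; have := H (lift 0 i); rewrite row_consS.
  move=> [Aa Ax] i; have [j ->|->] := unliftP 0 i; last by rewrite row_cons0.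
  by rewrite row_consS; exact: Ax.
have mB : measurable (\bigcap_(i in [set: 'I_n]) (row_coord i @^-1` A (lift 0 i))).
  apply: fin_bigcap_measurable; first exact: finite_finset.
  by move=> i _; rewrite -[X in measurable X]setTI; exact: measurable_row_coord.
move: mB; congr (measurable _).
by apply/seteqP; split => x /=; [move=> H i; exact: H|move=> H i _; exact: H].
Qed.

End row_lebesgue.

Section euclidean_calculus.
Context {R : realType} {N : nat}.
Local Notation E := 'rV[R]_N.

Definition dotv (a b : E) : R := \sum_(i < N) a 0 i * b 0 i.

(* The library norm on matrices is the max norm; this is the Euclidean one. *)
Definition enorm (a : E) : R := Num.sqrt (dotv a a).

Definition frob (A B : 'M[R]_N) : R := \sum_(i < N) \sum_(j < N) A i j * B i j.

Definition tensor (a b : E) : 'M[R]_N := \matrix_(i, j) (a 0 i * b 0 j).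

Definition pderiv (i : 'I_N) (f : E -> R) : E -> R :=
  fun x => 'D_(delta_mx 0 i) f x.

Definition grad (f : E -> R) (x : E) : E := \row_i pderiv i f x.

Definition hess (f : E -> R) (x : E) : 'M[R]_N :=
  \matrix_(i, j) pderiv i (pderiv j f) x.

Definition laplacian (f : E -> R) (x : E) : R :=
  \sum_(i < N) pderiv i (pderiv i f) x.

Definition divergence (v : E -> E) (x : E) : R :=
  \sum_(i < N) pderiv i (fun y => v y 0 i) x.

(* entries \partial_j v_i: the transpose of the library's jacobian, which acts
   on row vectors from the right *)
Definition nabla (v : E -> E) (x : E) : 'M[R]_N :=
  \matrix_(i, j) pderiv j (fun y => v y 0 i) x.

(* matrix times column vector, with vectors stored as rows *)
Definition mxvmul (A : 'M[R]_N) (a : E) : E := (A *m a^T)^T.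

(* C^oo: every iterated partial derivative is (Frechet) differentiable *)
Definition smooth_on (Omega : set E) (f : E -> R) :=
  forall (l : seq 'I_N) x, Omega x -> differentiable (foldr pderiv f l) x.

Definition test_function (Omega : set E) (w : E -> R) :=
  [/\ smooth_on setT w, compact (closure [set x | w x != 0]) &
      closure [set x | w x != 0] `<=` Omega].

(* Near each boundary point the open set Omega is the strict epigraph, in some
   unit direction e, of a Lipschitz function on the hyperplane orthogonal to e. *)
Definition lipschitz_boundary (Omega : set E) :=
  forall p, (closure Omega `\` interior Omega) p ->
  exists (e : E) (U : set E) (gamma : E -> R),
    [/\ enorm e = 1, open U, U p,
        [lipschitz gamma y | y in [set y | dotv y e = 0]] &
        Omega `&` U =
          [set x | gamma (x - dotv x e *: e) < dotv x e] `&` U].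

End euclidean_calculus.

Section gradient_flow.
Context {R : realType} {N : nat}.
Local Notation E := 'rV[R]_N.
Local Notation leb := (lebesgue_row N).

Definition is_L2_gradient (Omega : set E) (F : (E -> R) -> R) (u g : E -> R) :=
  forall w, test_function Omega w ->
    leb.-integrable Omega (EFin \o (fun x => g x * w x)) /\
    (F (fun x => u x + s * w x) - F u) / s @[s --> 0^'] -->
      \int[leb]_(x in Omega) (g x * w x).

Definition dt (u : R -> E -> R) (t : R) (x : E) : R := derive1 (fun s => u s x) t.

(* Time is rescaled by eps. An L2-gradient is only determined almost everywhere,
   hence the existential quantifier. *)
Definition L2_gradient_flow (Omega : set E) (F : (E -> R) -> R) (eps : R)
    (I : set R) (u : R -> E -> R) :=
  forall t, I t -> exists2 g, is_L2_gradient Omega F (u t) g &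
    forall x, Omega x -> dt u t x = - eps^-1 * g x.

End gradient_flow.

Section esedoglu_raetz_roeger.
Context {R : realType} {N : nat}.
Local Notation E := 'rV[R]_N.
Local Notation leb := (lebesgue_row N).

Definition double_well (s : R) : R := 2^-1 * s ^+ 2 * (1 - s) ^+ 2.
Local Notation W' := (derive1 double_well).
Local Notation W'' := (derive1n 2 double_well).

Definition unit_normal (u : E -> R) (x : E) : E :=
  (enorm (grad u x))^-1 *: grad u x.

Definition normal_proj (u : E -> R) (x : E) : 'M[R]_N :=
  tensor (unit_normal u x) (unit_normal u x).

Definition willmore_defect (eps : R) (u : E -> R) (x : E) : R :=
  eps * laplacian u x - W' (u x) / eps.

Definition profile_defect (eps : R) (u : E -> R) (x : E) : R :=
  eps * frob (hess u x) (normal_proj u x) - W' (u x) / eps.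

Definition err_energy (Omega : set E) (eps alpha beta : R) (u : E -> R) : R :=
  (2 * eps)^-1 * \int[leb]_(x in Omega) (willmore_defect eps u x ^+ 2)
  + beta * (eps `^ (1 + alpha))^-1 *
      \int[leb]_(x in Omega) (profile_defect eps u x ^+ 2).

Definition finite_err_energy (Omega : set E) (eps : R) (u : E -> R) :=
  leb.-integrable Omega (EFin \o (fun x => willmore_defect eps u x ^+ 2)) /\
  leb.-integrable Omega (EFin \o (fun x => profile_defect eps u x ^+ 2)).

Record err_system (Omega : set E) (eps alpha beta : R) (I : set R)
    (u mu xi L B : R -> E -> R) : Prop := {
  err_evolution : forall t x, I t -> Omega x ->
    eps ^+ 2 * dt u t x =
      laplacian (mu t) x - (eps ^+ 2)^-1 * W'' (u t x) * mu t x - beta * L t x ;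
  err_mu : forall t x, I t -> Omega x ->
    mu t x = W' (u t x) - eps ^+ 2 * laplacian (u t) x ;
  err_xi : forall t x, I t -> Omega x ->
    xi t x = eps * frob (hess (u t) x) (normal_proj (u t) x)
             - W' (u t x) / eps ;
  err_L : forall t x, I t -> Omega x ->
    L t x = 2 * eps `^ (1 - alpha) *
      ((frob (normal_proj (u t) x) (hess (xi t) x)
        - (eps ^+ 2)^-1 * W'' (u t x) * xi t x)
       + 2 * dotv (divergence (unit_normal (u t)) x *: unit_normal (u t) x)
                  (grad (xi t) x)
       + B t x * xi t x) ;
  err_B : forall t x, I t -> Omega x ->
    let n := unit_normal (u t) in
    B t x = divergence (fun y => divergence n y *: n y) x
            - divergence (fun y => mxvmul (nabla n y) (n y)) x
}.

End esedoglu_raetz_roeger.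

(* Main.v *)
Require Import Defs.
From mathcomp Require Import all_boot all_order all_algebra.
From mathcomp Require Import all_classical all_reals all_analysis.
From mathcomp Require Import measurable_realfun ring lra.

(** The statement is a computation of a first variation, followed by a uniqueness
    argument.

    For a fixed time, write n for grad u / |grad u|, N for n (x) n, a for the
    Willmore defect eps Lap u - W'(u) / eps and xi for the profile defect
    eps Hess u : N - W'(u) / eps. For a test function w, the defects of u + s w
    expand as
      a + s (eps Lap w - W''(u) w / eps) + O(s^2)  and
      xi + s (eps (N : Hess w + 2 (nabla n) n . grad w) - W''(u) w / eps) + O(s^2),
    uniformly on the support of w ([expands_willmore], [expands_profile]). The
    second expansion is the heart of the matter: N depends on grad u, and the
    variation of N paired with Hess u collapses to 2 (nabla n) n . grad w, by the
    symmetry of the Hessian. Outside the support of w nothing changes, so the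
    integrals of the squares are differentiable at s = 0
    ([integral_sq_variation]) even though the derivatives of u need not be
    bounded up to the boundary of Omega.

    Integrating by parts moves the derivatives from w to the defects. For the
    profile part this yields the divergence of the divergence of xi N minus twice
    the divergence of xi (nabla n) n. Expanding the products, the terms
    containing (nabla n) n . grad xi cancel, and what remains is
      N : Hess xi + 2 (div n) n . grad xi + (div ((div n) n) - div ((nabla n) n)) xi
    ([adjoint_identity]), the operator of the system. Since mu = - eps a, the
    explicit function [err_gradient], which is smooth on Omega, is therefore an
    L2-gradient of the energy ([is_L2_gradient_err]).

    Conversely, an L2-gradient realizing the flow is -eps times the continuous
    function [dt u t] on Omega, and two continuous L2-gradients agree on Omega by
    the fundamental lemma of the calculus of variations ([test_integral_eq0]). So
    the flow says exactly that eps^2 [dt u t] is [flow_speed]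
    ([flow_speedP]), and so does the system once mu, xi, L and B are eliminated
    ([err_systemP]).

    The analysis rests on three facts about the Lebesgue measure of row vectors,
    which is an iterated product: continuous functions are measurable for the
    coordinate sigma-algebra, balls have positive measure, and the partial
    derivatives of compactly supported functions have integral 0
    ([integral_pderiv_eq0]). Everything that multiplies a test function is
    smooth on Omega, so all integrands in the integrations by parts are again
    test functions. *)

Set Implicit Arguments.
Unset Strict Implicit.
Unset Printing Implicit Defensive.
Import Order.TTheory GRing.Theory Num.Theory.
Import numFieldNormedType.Exports.
Local Open Scope classical_set_scope.
Local Open Scope ring_scope.

(** * Borel sets and Lebesgue measure of row vectors *)

Section row_borel.
Context {R : realType}.

Lemma measurable_row_box n (A : 'I_n -> set R) :
  (forall i, measurable (A i : set (measurableTypeR R))) ->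
  measurable [set x : 'rV[R]_n | forall i, A i (x 0 i)].
Proof.
move=> mA.
have -> : [set x : 'rV[R]_n | forall i, A i (x 0 i)] =
    \bigcap_(i in [set: 'I_n]) (row_coord i @^-1` A i).
  by apply/seteqP; split => x /= H i; [move=> _|]; apply: H.
apply: fin_bigcap_measurable; first exact: finite_finset.
by move=> i _; rewrite -[X in measurable X]setTI; exact: measurable_row_coord.
Qed.

Lemma ball_rowE n (c : 'rV[R]_n) r : 0 < r ->
  ball c r = [set x : 'rV[R]_n | forall i, `|c 0 i - x 0 i| < r].
Proof.
move=> r0; apply/seteqP; split => x /=; first by move=> [_ H] i; exact: H.
by move=> H; split => // i j; rewrite ord1; exact: H.
Qed.

Lemma measurable_row_ball n (c : 'rV[R]_n) r : 0 < r -> measurable (ball c r).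
Proof.
move=> r0; rewrite ball_rowE//.
apply: (@measurable_row_box _ (fun i => [set y : R | `|c 0 i - y| < r])) => i.
apply: open_measurable.
rewrite (_ : [set _ | _] = ball (c 0 i) r)//; exact: ball_open.
Qed.

(** The balls with rational centre and radius 1/(k+1) contained in an open set
    are countably many and cover it; each of them is a box. *)
Lemma row_open_measurable n (U : set 'rV[R]_n) : open U -> measurable U.
Proof.
move=> oU.
pose c (q : 'rV[rat]_n * nat) : 'rV[R]_n := map_mx ratr q.1.
pose D (q : 'rV[rat]_n * nat) : set 'rV[R]_n := ball (c q) q.2.+1%:R^-1.
pose F q := if `[< D q `<=` U >] then D q else set0.
have -> : U = \bigcup_q F q.
  apply/seteqP; split => x; last first.
    by move=> [q _]; rewrite /F; case: ifPn => // /asboolP; exact.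
  move=> Ux; have [e /= e0 xeU] : nbhs_ball x U.
    by apply/nbhs_ballP; apply: open_nbhs_nbhs; split.
  (* centre and radius within e / 2 of x keep the ball inside ball x e *)
  have [k ke] : exists k : nat, k.+1%:R^-1 < e / 2.
    have e20 : 0 < e / 2 by rewrite divr_gt0.
    have [k _ /(_ k (leqnn k))] := near_infty_natSinv_lt (PosNum e20).
    by exists k.
  have k0 : 0 < k.+1%:R^-1 :> R by [].
  have /fin_all_exists[q qx] i : exists q : rat, `|ratr q - x 0 i| < k.+1%:R^-1.
    have /rat_in_itvoo[q] : x 0 i - k.+1%:R^-1 < x 0 i + k.+1%:R^-1.
      by rewrite ltrD2l gtrN.
    rewrite in_itv /= => /andP[q1 q2]; exists q.
    by rewrite ltr_distl q1 q2.
  exists (\row_i q i, k) => //; rewrite /F; case: ifPn => [_|/asboolP].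
    by rewrite /D ball_rowE// => i; rewrite !mxE.
  case => y; rewrite /D ball_rowE// => H; apply: xeU; rewrite ball_rowE// => i.
  have := H i; rewrite !mxE /= => {}H.
  rewrite (le_lt_trans (ler_distD (ratr (q i)) _ _))//.
  by rewrite distrC (lt_trans (ltrD (qx i) H))// (splitr e) ltrD.
apply: countable_bigcupT_measurable => [|q]; first exact: countableP.
rewrite /F; case: ifP => // _; exact: measurable_row_ball.
Qed.

(** The connection between the topology of row vectors and the sigma-algebra
    generated by the coordinates, on which every integral below relies. *)
Lemma row_continuous_measurable n (D : set 'rV[R]_n) (f : 'rV[R]_n -> R) :
  open D -> (forall x, D x -> {for x, continuous f}) -> measurable_fun D f.
Proof.
move=> oD cf; apply: (measurability _ (RGenOpens.measurableE R)).
move=> _ [_ [a [b ->] <-]]; apply: row_open_measurable.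
rewrite openE => x [Dx fx]; apply: filterI; first exact: open_nbhs_nbhs.
apply: cf => //; apply: open_nbhs_nbhs; split => //; exact: interval_open.
Qed.

Definition cube n (M : R) : set 'rV[R]_n := [set x | forall i, `|x 0 i| <= M].

Lemma bounded_set_cube n (A : set 'rV[R]_n) : bounded_set A ->
  exists2 M, 0 < M & A `<=` cube M.
Proof.
move=> [M [_ /(_ (`|M| + 1))]].
have -> : M < `|M| + 1 by rewrite (le_lt_trans (ler_norm _))// ltrDl.
move=> /(_ isT) H; exists (`|M| + 1); first by rewrite ltr_pwDr.
move=> x /H /= xM i; apply: le_trans xM.
by rewrite [leRHS]/Num.Def.normr /= mx_normrE; apply/bigmax_geP; right => /=; exists (0, i).
Qed.

Lemma norm_le_itv (M : R) : [set y : R | `|y| <= M] = [set` `[-M, M]].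
Proof. by apply/seteqP; split => y /=; rewrite in_itv/= ler_norml. Qed.

Lemma measurable_cube n M : measurable (@cube n M).
Proof.
apply: (@measurable_row_box _ (fun=> [set y : R | `|y| <= M])) => i.
by rewrite norm_le_itv; exact: measurable_itv.
Qed.

Lemma lebesgue_cube_lty n M : (lebesgue_row n (@cube n M) < +oo)%E.
Proof.
rewrite /cube (@lebesgue_row_box _ _ (fun=> [set y : R | `|y| <= M])).
  rewrite norm_le_itv big_const_ord; elim: n => [|n IH] /=; first by rewrite ltry.
  have L : (lebesgue_measure [set` `[(- M)%R, M%R]] < +oo)%E.
    by rewrite lebesgue_measure_itv; case: ifP => // _; rewrite -EFinD ltry.
  by apply: lte_mul_pinfty => //; rewrite ge0_fin_numE.
by move=> i; rewrite norm_le_itv; exact: measurable_itv.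
Qed.

Lemma lebesgue_ball_gt0 n (c : 'rV[R]_n) r : 0 < r ->
  (0 < lebesgue_row n (ball c r))%E.
Proof.
move=> r0; rewrite ball_rowE//.
have E i : [set y : R | `|c 0 i - y| < r] = [set` `]c 0 i - r, c 0 i + r[].
  apply/seteqP; split => y /=; rewrite in_itv/= ltr_norml => /andP[*];
    by apply/andP; split; lra.
rewrite (@lebesgue_row_box _ _ (fun i => [set y : R | `|c 0 i - y| < r])).
  elim/big_ind: _ => //; first by move=> x y x0 y0; rewrite mule_gt0.
  move=> i _; rewrite E lebesgue_measure_itv/= lte_fin ifT; last by lra.
  by rewrite -EFinD lte_fin; lra.
by move=> i; rewrite E; exact: measurable_itv.
Qed.

End row_borel.

(** * Integrals of compactly supported derivatives *)

Section divergence_theorem.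
Context {R : realType}.

Lemma compact_cube n M : compact (@cube R n M).
Proof.
have -> : @cube R n M = [set v | forall i, [set` `[-M, M]] (v ord0 i)].
  by apply/seteqP; split => x /= H i; have := H i; rewrite in_itv/= ler_norml.
by apply: (@rV_compact _ _ (fun=> [set` `[-M, M]])) => i; exact: segment_compact.
Qed.

Lemma continuous_bounded_on n (K : set 'rV[R]_n) (f : 'rV[R]_n -> R) :
  compact K -> (forall x, K x -> {for x, continuous f}) ->
  exists2 M, 0 < M & forall x, K x -> `|f x| <= M.
Proof.
move=> cK cf.
have : compact (f @` K).
  apply: continuous_compact => //.
  apply: continuous_in_subspaceT => x; rewrite inE; exact: cf.
move=> /compact_bounded [M [_ /(_ (`|M| + 1))]].
have -> : M < `|M| + 1 by rewrite (le_lt_trans (ler_norm _))// ltrDl.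
move=> /(_ isT) H; exists (`|M| + 1); first by rewrite ltr_pwDr.
by move=> x Kx; apply: H; exists x.
Qed.

Lemma cube_supported_integrable n (D : set 'rV[R]_n) (f : 'rV[R]_n -> R) M :
  measurable D -> continuous f -> (forall x, ~ cube M x -> f x = 0) ->
  (lebesgue_row n).-integrable D (EFin \o f).
Proof.
move=> mD cf f0; apply: (@integrableS _ _ _ _ setT) => //.
have -> : EFin \o f = (EFin \o f) \_ (cube M).
  apply/funext => x; rewrite patchE; case: ifPn => //.
  by rewrite notin_setE => /f0 /= ->.
apply/integrable_restrict => //; first exact: measurable_cube.
rewrite setTI; apply: measurable_bounded_integrable.
- exact: measurable_cube.
- exact: lebesgue_cube_lty.
- apply: (@measurable_funS _ _ _ _ setT) => //.
  by apply: row_continuous_measurable => [|x _]; [exact: openT|exact: cf].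
- have [B B0 HB] := continuous_bounded_on (@compact_cube n M) (fun x _ => cf x).
  exists B; split; first exact: num_real.
  by move=> x Bx y /HB /le_trans; apply; exact: ltW.
Qed.

Lemma row_cons_le n (a b : R) (x y : 'rV[R]_n) e : 0 < e ->
  `|a - b| < e -> ball x e y -> ball (row_cons (a, x)) e (row_cons (b, y)).
Proof.
move=> e0 ab; rewrite !ball_rowE// => xy i.
by have [j ->|->] := unliftP 0 i; rewrite ?row_consS ?row_cons0//; exact: xy.
Qed.

Lemma row_cons_continuousr n (a : R) : continuous (fun x : 'rV[R]_n => row_cons (a, x)).
Proof.
move=> x B /nbhs_ballP[e /= e0 eB].
apply/nbhs_ballP; exists e => //= y xy; apply: eB.
by apply: row_cons_le => //; rewrite subrr normr0.
Qed.

Lemma row_cons_continuousl n (x : 'rV[R]_n) :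
  continuous (fun a : R => row_cons (a : measurableTypeR R, x)).
Proof.
move=> a B /nbhs_ballP[e /= e0 eB].
apply/nbhs_ballP; exists e => //= b ab; apply: eB.
by apply: row_cons_le => //; exact: ballxx.
Qed.

(** [row_cons] is linear, so moving along a basis vector in dimension n.+1 is
    moving along one of the two factors; this is what lets directional
    derivatives pass through the recursive definition of the measure. *)
Lemma row_consD n (a b s : R) (x y : 'rV[R]_n) :
  row_cons (s *: a + b, s *: x + y) = s *: row_cons (a, x) + row_cons (b, y).
Proof.
by apply/rowP => i; rewrite [RHS]mxE [X in _ = X + _]mxE;
  have [j ->|->] := unliftP 0 i; rewrite ?row_consS ?row_cons0 //= !mxE.
Qed.

Lemma delta_row_cons0 n : delta_mx 0 0 = row_cons (1, 0) :> 'rV[R]_n.+1.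
Proof.
by apply/rowP => i; have [j ->|->] := unliftP 0 i;
  rewrite ?row_consS ?row_cons0 mxE//= mxE.
Qed.

Lemma delta_row_consS n (j : 'I_n) :
  delta_mx 0 (lift 0 j) = row_cons (0, delta_mx 0 j) :> 'rV[R]_n.+1.
Proof.
by apply/rowP => i; have [k ->|->] := unliftP 0 i;
  rewrite ?row_consS ?row_cons0 mxE//= mxE (inj_eq lift_inj).
Qed.

Lemma growth_rate_eq (V V' : normedModType R) (f : V -> R) (g : V' -> R) x v y w :
  (forall s : R, f (s *: v + x) = g (s *: w + y)) ->
  (fun s : R => s^-1 *: ((f \o shift x) (s *: v) - f x)) =
  (fun s : R => s^-1 *: ((g \o shift y) (s *: w) - g y)).
Proof.
move=> fg; apply/funext => s /=; rewrite fg; congr (_ *: (_ - _)).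
by have := fg 0; rewrite !scale0r !add0r.
Qed.

(** A directional derivative only sees the restriction to a line, so two
    functions on different spaces with the same restriction have the same one. *)
Lemma derive_line_eq (V V' : normedModType R) (f : V -> R) (g : V' -> R) x v y w :
  (forall s : R, f (s *: v + x) = g (s *: w + y)) -> 'D_v f x = 'D_w g y.
Proof. by move=> fg; rewrite /derive (growth_rate_eq fg). Qed.

Lemma derivable_line_eq (V V' : normedModType R) (f : V -> R) (g : V' -> R) x v y w :
  (forall s : R, f (s *: v + x) = g (s *: w + y)) -> derivable f x v ->
  derivable g y w.
Proof. by move=> fg; rewrite /derivable (growth_rate_eq fg). Qed.

Lemma integral_derive_eq0 (g : R -> R) M : 0 < M ->
  (forall a, derivable g a 1) -> continuous (fun a => 'D_1 g a) ->
  (forall a, M < `|a| -> g a = 0) ->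
  (\int[lebesgue_measure]_a ('D_1 g a)%:E = 0)%E.
Proof.
move=> M0 dg cg g0.
have M1 : M < M + 1 by rewrite ltrDl.
have gM a : M < `|a| -> 'D_1 g a = 0.
  move=> Ma; rewrite (near_eq_derive _ (g := cst 0)) ?derive_cst//.
  have : nbhs a [set b | M < `|b|].
    apply: open_nbhs_nbhs; split => //.
    rewrite (_ : [set b : R | _] = Num.norm @^-1` [set b | M < b])//.
    apply: open_comp; last exact: open_gt.
    by move=> x _; exact: norm_continuous.
  by apply: filterS => b; exact: g0.
have -> : (\int[lebesgue_measure]_a ('D_1 g a)%:E =
    \int[lebesgue_measure]_(a in `[(- (M + 1))%R, (M + 1)%R]) ('D_1 g a)%:E)%E.
  rewrite [RHS]integral_mkcond; apply: eq_integral => a _; rewrite patchE.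
  case: ifPn => //; rewrite notin_setE /= in_itv/= -ler_norml => /negP.
  by rewrite -ltNge => Ma; rewrite gM// (lt_trans M1).
have dc : forall a, {for a, continuous g}.
  by move=> a; apply/differentiable_continuous/derivable1_diffP.
rewrite (@continuous_FTC2 _ _ g).
- by rewrite !g0 ?subee// ?normrN gtr0_norm//; lra.
- lra.
- by apply: continuous_subspaceT.
- split; first by move=> a _; exact: dg.
    by apply: cvg_at_right_filter; exact: dc.
  by apply: cvg_at_left_filter; exact: dc.
- by move=> a _; rewrite derive1E.
Qed.

(** By induction on the dimension and Fubini: integrating first in the direction
    of differentiation gives 0, by the fundamental theorem of calculus if this
    is the first coordinate, and by induction on the remaining coordinates
    otherwise. Only derivability along the direction is required, since this is
    what restricts well to slices. *)
Lemma integral_pderiv_eq0 n (h : 'rV[R]_n -> R) (i : 'I_n) M : 0 < M ->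
  (forall x, derivable h x (delta_mx 0 i)) -> continuous (pderiv i h) ->
  (forall x, ~ cube M x -> h x = 0) ->
  (\int[lebesgue_row n]_x (pderiv i h x)%:E = 0)%E.
Proof.
move=> M0; elim: n h i => [h [] //|n IH] h i dh ch h0.
have ph0 x : ~ cube M x -> pderiv i h x = 0.
  move=> Mx; rewrite /pderiv (near_eq_derive _ (g := cst 0)) ?derive_cst//.
  have : nbhs x (~` cube M).
    apply: open_nbhs_nbhs; split => //; apply: closed_openC.
    by apply: compact_closed; [exact: norm_hausdorff|exact: compact_cube].
  by apply: filterS => b; exact: h0.
have ih : (lebesgue_row n.+1).-integrable setT (EFin \o pderiv i h).
  exact: (@cube_supported_integrable _ setT (pderiv i h) M measurableT ch ph0).
have mh : measurable_fun setT (EFin \o pderiv i h) by case/integrableP: ih.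
have ipr : (lebesgue_measure \x lebesgue_row n)%E.-integrable setT
    ((EFin \o pderiv i h) \o @row_cons R n).
  apply/integrableP; split.
    by apply: measurableT_comp => //; exact: measurable_row_cons.
  case/integrableP: ih => _.
  rewrite /= ge0_integral_pushforward//; first exact: measurable_row_cons.
  by apply: (@measurableT_comp _ _ _ _ _ _ abse) mh.
rewrite [LHS](_ : _ = \int[lebesgue_measure \x lebesgue_row n]_z
    ((EFin \o pderiv i h) \o @row_cons R n) z)%E; last first.
  rewrite [LHS](integral_pushforward (@measurable_row_cons R n))//.
have [j ij|i0] := unliftP 0 i.
  have E a x s : h (s *: 'e_i + row_cons (a, x)) = h (row_cons (a, s *: 'e_j + x)).
    by rewrite ij delta_row_consS -row_consD scaler0 add0r.
  rewrite -integral12_prod_meas1//; apply: integral0_eq => a _.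
  rewrite /fubini_F /=.
  have D x : pderiv i h (row_cons (a, x)) = pderiv j (fun y => h (row_cons (a, y))) x.
    by apply: derive_line_eq => s; exact: E.
  under eq_integral do rewrite D.
  apply: IH.
  - move=> x; apply: derivable_line_eq (dh (row_cons (a, x))) => s; exact: E.
  - rewrite (_ : pderiv j _ = pderiv i h \o (fun y => row_cons (a, y))).
      by move=> x; apply: continuous_comp; [exact: row_cons_continuousr|exact: ch].
    by apply/funext => y; rewrite -D.
  - move=> x nx; apply: h0 => H; apply: nx => k.
    by have := H (lift 0 k); rewrite row_consS.
have E (a : R) x (s : R) : h (s *: 'e_i + row_cons (a : measurableTypeR R, x)) =
    h (row_cons (s *: 1 + a : measurableTypeR R, x)).
  by rewrite i0 delta_row_cons0 -row_consD scaler0 add0r.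
rewrite -integral21_prod_meas1//; apply: integral0_eq => x _.
rewrite /fubini_G /=.
pose hx (a : R) := h (row_cons (a : measurableTypeR R, x)).
have D a : pderiv i h (row_cons (a, x)) = 'D_1 hx a.
  by apply: derive_line_eq => s; exact: E.
under eq_integral do rewrite D.
apply: (integral_derive_eq0 M0).
- move=> a; apply: derivable_line_eq (dh (row_cons (a, x))) => s; exact: E.
- rewrite (_ : (fun _ => _) = pderiv i h \o (fun b : R => row_cons (b : measurableTypeR R, x))).
    by move=> a; apply: continuous_comp; [exact: row_cons_continuousl|exact: ch].
  by apply/funext => y; rewrite -D.
- by move=> a aM; apply: h0 => /(_ 0); rewrite row_cons0 /= leNgt aM.
Qed.

End divergence_theorem.

(** * Smooth functions *)

Section smooth_calculus.
Context {R : realType}.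

(** The differential of f at x is also a differential of g, as f and g agree near
    x; uniqueness of the differential then identifies it with that of g. *)
Lemma near_eq_differentiable (V W : normedModType R) (f g : V -> W) x :
  (\forall y \near x, f y = g y) -> differentiable f x -> differentiable g x.
Proof.
move=> fg df; have [cdf ef] := (iffLR (diff_locallyP _ _)) df.
have eg : g \o shift x = cst (g x) + 'd f x +o_ 0 id.
  apply/eqaddoP => e e0.
  have /eqaddoP/(_ e e0) := ef; apply: filterS2.
    2: by move: fg; rewrite (near_shift 0); exact: id.
  move=> y; rewrite /= subr0 => fgy; rewrite !fctE /= (nbhs_singleton fg).
  by rewrite fgy.
have dg := diff_unique cdf eg.
by apply/diff_locallyP; rewrite dg.
Qed.

Lemma derive_comp (V : normedModType R) (F : R -> R) (f : V -> R) x v :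
  differentiable f x -> derivable F (f x) 1 ->
  'D_v (F \o f) x = derive1 F (f x) * 'D_v f x.
Proof.
move=> df dF; have dF' : differentiable F (f x) by exact/derivable1_diffP.
rewrite !deriveE//; last exact: differentiable_comp.
by rewrite diff_comp//= diff1E// mulrC.
Qed.

Context {n : nat}.
Local Notation E := 'rV[R]_n.
Implicit Types (f g : E -> R) (x : E) (i : 'I_n) (Omega : set E).

(** Derivatives are local: identities on an open set can be differentiated. *)
Lemma pderiv_eq_on Omega f g i : open Omega -> {in Omega, f =1 g} ->
  {in Omega, pderiv i f =1 pderiv i g}.
Proof.
move=> oO fg x; rewrite inE => Ox; apply: near_eq_derive.
have : nbhs x Omega by exact: open_nbhs_nbhs.
by apply: filterS => y Oy; apply: fg; rewrite inE.
Qed.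

Lemma foldr_pderiv_eq_on Omega f g (l : seq 'I_n) : open Omega ->
  {in Omega, f =1 g} -> {in Omega, foldr pderiv f l =1 foldr pderiv g l}.
Proof.
by move=> oO fg; elim: l => //= i l IH; exact: pderiv_eq_on.
Qed.

Lemma smooth_differentiable Omega f x : smooth_on Omega f -> Omega x ->
  differentiable f x.
Proof. by move=> sf; exact: (sf [::]). Qed.

Lemma smooth_continuous Omega f x : smooth_on Omega f -> Omega x ->
  {for x, continuous f}.
Proof. by move=> sf Ox; apply: differentiable_continuous; exact: (sf [::]). Qed.

Lemma smooth_pderiv Omega f i : smooth_on Omega f -> smooth_on Omega (pderiv i f).
Proof. by move=> sf l x Ox; rewrite -foldr_rcons; exact: sf. Qed.

Lemma smooth_on_subset Omega Omega' f : Omega' `<=` Omega ->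
  smooth_on Omega f -> smooth_on Omega' f.
Proof. by move=> OO sf l x Ox; apply: sf; exact: OO. Qed.

(** A coinduction principle: a class of differentiable functions that is stable
    under partial derivatives, up to equality on the open set, consists of smooth
    functions. It reduces smoothness to one computation of a derivative. *)
Lemma smooth_coind Omega (C : (E -> R) -> Prop) : open Omega ->
  (forall f, C f -> forall x, Omega x -> differentiable f x) ->
  (forall f i, C f -> exists2 g, C g & {in Omega, pderiv i f =1 g}) ->
  forall f, C f -> smooth_on Omega f.
Proof.
move=> oO dC pC f Cf l; elim/last_ind: l f Cf => [f Cf x Ox|l i IH f Cf x Ox].
  exact: dC.
have [g Cg pg] := pC f i Cf.
rewrite foldr_rcons; apply: near_eq_differentiable (IH g Cg x Ox).
have : nbhs x Omega by exact: open_nbhs_nbhs.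
apply: filterS => y Oy; apply/esym.
by apply: (foldr_pderiv_eq_on _ oO pg); rewrite inE.
Qed.

Lemma pderiv_cst i (a : R) x : pderiv i (fun=> a) x = 0.
Proof. exact: derive_cst. Qed.

Lemma pderivD i f g x : differentiable f x -> differentiable g x ->
  pderiv i (fun y => f y + g y) x = pderiv i f x + pderiv i g x.
Proof. by move=> df dg; rewrite /pderiv (@deriveD _ _ _ f g)//; exact: diff_derivable. Qed.

Lemma pderivM i f g x : differentiable f x -> differentiable g x ->
  pderiv i (fun y => f y * g y) x = f x * pderiv i g x + g x * pderiv i f x.
Proof. by move=> df dg; rewrite /pderiv (@deriveM _ _ f g)//; exact: diff_derivable. Qed.

Lemma pderiv_comp i (F : R -> R) f x : differentiable f x -> derivable F (f x) 1 ->
  pderiv i (fun y => F (f y)) x = derive1 F (f x) * pderiv i f x.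
Proof. exact: derive_comp. Qed.

Lemma differentiableDf f g x : differentiable f x -> differentiable g x ->
  differentiable (fun y => f y + g y) x.
Proof. exact: differentiableD. Qed.

Lemma differentiableMf f g x : differentiable f x -> differentiable g x ->
  differentiable (fun y => f y * g y) x.
Proof. exact: differentiableM. Qed.

Lemma differentiable_comp1 (F : R -> R) f x : differentiable f x ->
  derivable F (f x) 1 -> differentiable (fun y => F (f y)) x.
Proof. by move=> df dF; apply: differentiable_comp => //; exact/derivable1_diffP. Qed.

(** The closure of the smooth functions under the operations needed for the
    normalized gradient. Each derivation rule expresses the derivative of an
    element through elements, so [smooth_coind] proves all the closure properties
    of smooth functions at once. *)
Inductive smooth_algebra Omega : (E -> R) -> Prop :=
| SmoothBase f : smooth_on Omega f -> smooth_algebra Omega f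
| SmoothCst a : smooth_algebra Omega (fun=> a)
| SmoothAdd f g : smooth_algebra Omega f -> smooth_algebra Omega g ->
    smooth_algebra Omega (fun x => f x + g x)
| SmoothMul f g : smooth_algebra Omega f -> smooth_algebra Omega g ->
    smooth_algebra Omega (fun x => f x * g x)
| SmoothInv f : smooth_algebra Omega f -> (forall x, Omega x -> f x != 0) ->
    smooth_algebra Omega (fun x => (f x)^-1)
| SmoothSqrt f : smooth_algebra Omega f -> (forall x, Omega x -> 0 < f x) ->
    smooth_algebra Omega (fun x => Num.sqrt (f x)).

Lemma derive1_inv (a : R) : a != 0 -> derivable (fun x : R => x^-1) a 1 /\
  derive1 (fun x : R => x^-1) a = - (a^-1 * a^-1).
Proof.
move=> a0; split; first exact: (@derivableV R R id).
rewrite derive1E (@deriveV R R id)// derive_id -exprVn expr2.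
by rewrite scaleNr /GRing.scale/= mulr1.
Qed.

Lemma smooth_algebra_differentiable Omega f x : smooth_algebra Omega f ->
  Omega x -> differentiable f x.
Proof.
move=> Cf Ox; elim: Cf => {f}.
- by move=> f /(_ [::]); apply.
- by move=> a; exact: differentiable_cst.
- by move=> f g _ df _ dg; exact: differentiableDf.
- by move=> f g _ df _ dg; exact: differentiableMf.
- move=> f _ df f0; apply: differentiable_comp1 => //.
  by have [] := derive1_inv (f0 x Ox).
- move=> f _ df f0; apply: differentiable_comp1 => //.
  by case: (is_derive1_sqrt (f0 x Ox)).
Qed.

Lemma smooth_algebra_smooth Omega f : open Omega -> smooth_algebra Omega f ->
  smooth_on Omega f.
Proof.
move=> oO; move: f; apply: smooth_coind => // [f Cf x|f i Cf].
  exact: smooth_algebra_differentiable.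
elim: Cf => {f}.
- by move=> f sf; exists (pderiv i f) => //; apply: SmoothBase; exact: smooth_pderiv.
- move=> a; exists (fun=> 0); first exact: SmoothCst.
  by move=> x _; rewrite pderiv_cst.
- move=> f g Cf [f' Cf' ff'] Cg [g' Cg' gg'].
  exists (fun x => f' x + g' x); first exact: SmoothAdd.
  move=> x Ox; rewrite -ff'// -gg'// pderivD//; rewrite inE in Ox;
    exact: smooth_algebra_differentiable Ox.
- move=> f g Cf [f' Cf' ff'] Cg [g' Cg' gg'].
  exists (fun x => f x * g' x + g x * f' x).
    by apply: SmoothAdd; apply: SmoothMul.
  move=> x Ox; rewrite -ff'// -gg'// pderivM//; rewrite inE in Ox;
    exact: smooth_algebra_differentiable Ox.
- move=> f Cf [f' Cf' ff'] f0.
  exists (fun x => (-1 * ((f x)^-1 * (f x)^-1)) * f' x).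
    apply: SmoothMul => //; apply: SmoothMul; first exact: SmoothCst.
    by apply: SmoothMul; exact: SmoothInv.
  move=> x Ox; rewrite -ff'//; rewrite inE in Ox.
  have [dV eV] := derive1_inv (f0 x Ox).
  rewrite (@pderiv_comp _ (fun y : R => y^-1))//; first by rewrite eV mulN1r.
  exact: smooth_algebra_differentiable Ox.
- move=> f Cf [f' Cf' ff'] f0.
  exists (fun x => (2 * Num.sqrt (f x))^-1 * f' x).
    apply: SmoothMul => //; apply: SmoothInv.
      by apply: SmoothMul; [exact: SmoothCst|exact: SmoothSqrt].
    by move=> x Ox; rewrite mulf_neq0// lt0r_neq0// sqrtr_gt0 f0.
  move=> x Ox; rewrite -ff'//; rewrite inE in Ox.
  have H := is_derive1_sqrt (f0 x Ox).
  rewrite (@pderiv_comp _ Num.sqrt)//; first by rewrite derive1E derive_val.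
    exact: smooth_algebra_differentiable Ox.
Qed.

Lemma smooth_cst Omega (a : R) : open Omega -> smooth_on Omega (fun=> a).
Proof. by move=> oO; apply: smooth_algebra_smooth => //; exact: SmoothCst. Qed.

Lemma smoothD Omega f g : open Omega -> smooth_on Omega f -> smooth_on Omega g ->
  smooth_on Omega (fun x => f x + g x).
Proof.
by move=> oO sf sg; apply: smooth_algebra_smooth => //; apply: SmoothAdd; exact: SmoothBase.
Qed.

Lemma smoothM Omega f g : open Omega -> smooth_on Omega f -> smooth_on Omega g ->
  smooth_on Omega (fun x => f x * g x).
Proof.
by move=> oO sf sg; apply: smooth_algebra_smooth => //; apply: SmoothMul; exact: SmoothBase.
Qed.

Lemma smoothN Omega f : open Omega -> smooth_on Omega f ->
  smooth_on Omega (fun x => - f x).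
Proof.
move=> oO sf; rewrite (_ : (fun _ => _) = (fun x => (-1) * f x)).
  by apply: smoothM => //; exact: smooth_cst.
by apply/funext => x; rewrite mulN1r.
Qed.

Lemma smoothV Omega f : open Omega -> smooth_on Omega f ->
  (forall x, Omega x -> f x != 0) -> smooth_on Omega (fun x => (f x)^-1).
Proof.
by move=> oO sf f0; apply: smooth_algebra_smooth => //; apply: SmoothInv => //; exact: SmoothBase.
Qed.

Lemma smooth_sqrt Omega f : open Omega -> smooth_on Omega f ->
  (forall x, Omega x -> 0 < f x) -> smooth_on Omega (fun x => Num.sqrt (f x)).
Proof.
by move=> oO sf f0; apply: smooth_algebra_smooth => //; apply: SmoothSqrt => //; exact: SmoothBase.
Qed.

Lemma smooth_eq_on Omega f g : open Omega -> {in Omega, f =1 g} ->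
  smooth_on Omega f -> smooth_on Omega g.
Proof.
move=> oO fg sf l x Ox; apply: near_eq_differentiable (sf l x Ox).
have : nbhs x Omega by exact: open_nbhs_nbhs.
by apply: filterS => y Oy; apply: (foldr_pderiv_eq_on _ oO fg); rewrite inE.
Qed.

Lemma smooth_sum Omega (I : finType) (F : I -> E -> R) : open Omega ->
  (forall k, smooth_on Omega (F k)) -> smooth_on Omega (fun x => \sum_k F k x).
Proof.
move=> oO sF; elim: (index_enum I) => [|k s IH].
  rewrite (_ : (fun _ => _) = (fun=> 0)); first exact: smooth_cst.
  by apply/funext => x; rewrite big_nil.
rewrite (_ : (fun _ => _) = (fun x => F k x + \sum_(j <- s) F j x)).
  exact: smoothD.
by apply/funext => x; rewrite big_cons.
Qed.

End smooth_calculus.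

(** * Symmetry of second derivatives *)

Section schwarz.
Context {R : realType} {n : nat}.
Local Notation E := 'rV[R]_n.
Implicit Types (f : E -> R) (x y : E) (i j : 'I_n) (Omega : set E).

Lemma derivable_line f x i (s : R) : differentiable f (s *: 'e_i + x) ->
  is_derive s 1 (fun t : R => f (t *: 'e_i + x)) (pderiv i f (s *: 'e_i + x)).
Proof.
move=> df; have L (t : R) : f (t *: 'e_i + (s *: 'e_i + x)) = f ((t *: 1 + s) *: 'e_i + x).
  by rewrite addrA -scalerDl /GRing.scale/= mulr1.
split; first exact: derivable_line_eq L (diff_derivable df).
rewrite /pderiv (derive_line_eq (g := fun t : R => f (t *: 'e_i + x)) L).
by [].
Qed.

Lemma line_MVT f x i (h : R) : 0 < h ->
  (forall s, 0 <= s <= h -> differentiable f (s *: 'e_i + x)) ->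
  exists2 s, 0 <= s <= h & f (h *: 'e_i + x) - f x = pderiv i f (s *: 'e_i + x) * h.
Proof.
move=> h0 df.
have [s||s] := @MVT R (fun t => f (t *: 'e_i + x))
  (fun s => pderiv i f (s *: 'e_i + x)) 0 h h0.
- by rewrite in_itv/= => /andP[s0 sh]; apply: derivable_line; apply: df; rewrite !ltW.
- apply: continuous_in_subspaceT => s; rewrite inE/= in_itv/= => sh.
  have [dL _] := derivable_line (df s sh).
  by apply: differentiable_continuous; exact/derivable1_diffP.
- rewrite in_itv/= => /andP[s0 sh].
  by rewrite scale0r add0r subr0 => E1; exists s => //; rewrite !ltW.
Qed.

Lemma pderiv_shift f i (c x : E) :
  pderiv i (fun y => f (c + y)) x = pderiv i f (c + x).
Proof.
apply: (@derive_line_eq _ E E (fun y => f (c + y)) f) => t.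
by rewrite addrCA.
Qed.

Lemma differentiable_shift f (c x : E) : differentiable f (c + x) ->
  differentiable (fun y => f (c + y)) x.
Proof.
by move=> df; apply: (@differentiable_comp _ E E R (fun y => c + y) f).
Qed.

Lemma pderivB f g i x : differentiable f x -> differentiable g x ->
  pderiv i (fun y => f y - g y) x = pderiv i f x - pderiv i g x.
Proof.
by move=> df dg; rewrite /pderiv (@deriveB _ _ _ f g)//; exact: diff_derivable.
Qed.

Definition second_difference f x i j (h : R) :=
  f (h *: 'e_i + (h *: 'e_j + x)) - f (h *: 'e_i + x) - (f (h *: 'e_j + x) - f x).

Lemma second_differenceC f x i j h :
  second_difference f x i j h = second_difference f x j i h.
Proof. by rewrite /second_difference [h *: 'e_i + (_ + x)]addrCA; ring. Qed.

(** The mean value theorem applied in direction i to the increment of f in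
    direction j, and then in direction j to the derivative. *)
Lemma second_difference_MVT Omega f x i j (h r : R) : open Omega ->
  smooth_on Omega f -> ball x r `<=` Omega -> 0 < h -> h + h < r ->
  exists2 y, ball x r y &
    second_difference f x i j h = pderiv j (pderiv i f) y * h * h.
Proof.
move=> oO sf xr h0 hr.
have B (s t : R) : 0 <= s <= h -> 0 <= t <= h -> ball x r (t *: 'e_j + (s *: 'e_i + x)).
  move=> /andP[s0 sh] /andP[t0 th]; rewrite ball_rowE; last by lra.
  move=> k; rewrite !mxE /=; case: (k == i); case: (k == j);
    rewrite /= ?mulr1n ?mulr0n ?mulr1 ?mulr0 ltr_norml; apply/andP; split; lra.
have h00 : 0 <= (0 : R) <= h by rewrite lexx ltW.
have hh : 0 <= h <= h by rewrite lexx ltW.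
pose g y := f (h *: 'e_j + y) - f y.
have dg (s : R) : 0 <= s <= h -> differentiable g (s *: 'e_i + x) /\
    pderiv i g (s *: 'e_i + x) =
    pderiv i f (h *: 'e_j + (s *: 'e_i + x)) - pderiv i f (s *: 'e_i + x).
  move=> sh.
  have d1 : differentiable f (s *: 'e_i + x).
    by apply: (smooth_differentiable sf); apply: xr; have := B s 0 sh h00; rewrite scale0r add0r.
  have d2 : differentiable f (h *: 'e_j + (s *: 'e_i + x)).
    by apply: (smooth_differentiable sf); apply: xr; exact: B.
  have d3 := differentiable_shift d2.
  split; first exact: (@differentiableB _ _ _ (fun y => f (h *: 'e_j + y)) f).
  have := pderivB i d3 d1; rewrite (pderiv_shift f i (h *: 'e_j)).
  exact.
have [s sh Es] := line_MVT h0 (fun s sh => (dg s sh).1).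
have [t th Et] : exists2 t, 0 <= t <= h & pderiv i f (h *: 'e_j + (s *: 'e_i + x)) -
    pderiv i f (s *: 'e_i + x) =
    pderiv j (pderiv i f) (t *: 'e_j + (s *: 'e_i + x)) * h.
  apply: (@line_MVT (pderiv i f) (s *: 'e_i + x) j h h0) => t th.
  exact: (smooth_differentiable (smooth_pderiv i sf) (xr _ (B s t sh th))).
exists (t *: 'e_j + (s *: 'e_i + x)); first exact: B.
have -> : second_difference f x i j h = g (h *: 'e_i + x) - g x.
  by rewrite /second_difference /g addrCA; ring.
by rewrite Es (dg s sh).2 Et.
Qed.

(** The second difference is symmetric in i and j, and divided by h^2 it is a value
    of either mixed derivative near x; both are continuous at x. *)
Lemma pderivC Omega f x i j : open Omega -> smooth_on Omega f -> Omega x ->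
  pderiv i (pderiv j f) x = pderiv j (pderiv i f) x.
Proof.
move=> oO sf Ox; apply/eqP; rewrite -subr_eq0 -normr_le0.
apply/ler_addgt0Pl => e e0; rewrite addr0.
have e2 : 0 < e / 2 by rewrite divr_gt0.
have near_ k l : \forall y \near x, `|pderiv k (pderiv l f) x - pderiv k (pderiv l f) y| < e / 2.
  have /cvgrPdist_lt/(_ _ e2) := smooth_continuous (smooth_pderiv k (smooth_pderiv l sf)) Ox.
  by [].
have : \forall y \near x, [/\ Omega y,
   `|pderiv i (pderiv j f) x - pderiv i (pderiv j f) y| < e / 2 &
   `|pderiv j (pderiv i f) x - pderiv j (pderiv i f) y| < e / 2].
  have : nbhs x Omega by exact: open_nbhs_nbhs.
  by apply: filterS3 (near_ i j) (near_ j i) => y; split.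
move=> /nbhs_ballP[r /= r0 xr].
have h0 : 0 < r / 3 by rewrite divr_gt0.
have hr : r / 3 + r / 3 < r by lra.
have xrO : ball x r `<=` Omega by move=> y /xr[].
(* the step r / 3 keeps both increments together below r *)
have [y1 /xr[_ _ b1] E1] := second_difference_MVT i j oO sf xrO h0 hr.
have [y2 /xr[_ b2 _] E2] := second_difference_MVT j i oO sf xrO h0 hr.
have r30 : r / 3 != 0 by exact: lt0r_neq0.
rewrite second_differenceC E2 in E1.
have E12 := mulIf r30 (mulIf r30 E1); rewrite E12 in b2.
apply: (le_trans (ler_distD (pderiv j (pderiv i f) y1) _ _)).
rewrite (splitr e); apply: lerD; apply: ltW; first exact: b2.
by rewrite distrC; exact: b1.
Qed.

End schwarz.

(** * Test functions *)

Section test_functions.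
Context {R : realType} {n : nat}.
Local Notation E := 'rV[R]_n.
Local Notation leb := (lebesgue_row n).
Local Notation supp w := (closure [set x | w x != 0]).
Implicit Types (f g w : E -> R) (x : E) (i : 'I_n) (Omega K : set E).

Lemma out_support0 w x : ~ supp w x -> w x = 0.
Proof.
move=> nx; apply/eqP/negPn/negP => wx; apply: nx; exact: subset_closure.
Qed.

Lemma vanishing_pderiv0 K w i x : closed K -> (forall y, ~ K y -> w y = 0) ->
  ~ K x -> pderiv i w x = 0.
Proof.
move=> cK w0 nx; rewrite /pderiv (near_eq_derive _ (g := cst 0)) ?derive_cst//.
have : nbhs x (~` K) by apply: open_nbhs_nbhs; split => //; exact: closed_openC.
by apply: filterS => y; exact: w0.
Qed.

(** Smoothness on Omega suffices for a function that vanishes off a compact part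
    of Omega, because off this part it is locally 0. So a product with a test
    function is a test function as soon as the other factor is smooth on Omega. *)
Lemma test_functionI Omega K w : open Omega -> compact K -> K `<=` Omega ->
  (forall x, ~ K x -> w x = 0) -> smooth_on Omega w -> test_function Omega w.
Proof.
move=> oO cK KO w0 sw.
have clK : closed K by apply: compact_closed => //; exact: norm_hausdorff.
have sK : supp w `<=` K.
  rewrite [X in _ `<=` X](iffLR (closure_id K) clK); apply: closure_subset => x /= wx.
  by apply/not_notP => /w0 E0; rewrite E0 eqxx in wx.
split; last by apply: subset_trans KO.
  move=> l x _; have [Kx|nKx] := pselect (K x); first by apply: sw; exact: KO.
  have oK : open (~` K) by exact: closed_openC.
  apply: (@smooth_eq_on _ _ (~` K) (fun=> 0)) => //; last exact: smooth_cst.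
  by move=> y; rewrite inE => /w0.
apply: (subclosed_compact _ cK sK); exact: closed_closure.
Qed.

Lemma test_support_compact Omega w : test_function Omega w -> compact (supp w).
Proof. by case. Qed.

Lemma test_support_sub Omega w : test_function Omega w -> supp w `<=` Omega.
Proof. by case. Qed.

Lemma test_smooth Omega w : test_function Omega w -> smooth_on Omega w.
Proof. by case=> sw _ _; apply: smooth_on_subset sw; exact: subsetT. Qed.

Lemma test_differentiable Omega w x : test_function Omega w -> differentiable w x.
Proof. by case=> sw _ _; exact: (sw [::]). Qed.

Lemma test_continuous Omega w : test_function Omega w -> continuous w.
Proof. by move=> tw x; apply: differentiable_continuous; exact: test_differentiable tw. Qed.

Lemma testMl Omega f w : open Omega -> smooth_on Omega f -> test_function Omega w ->
  test_function Omega (fun x => f x * w x).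
Proof.
move=> oO sf tw; apply: (test_functionI oO (test_support_compact tw) (test_support_sub tw)).
  by move=> x nx; rewrite (out_support0 nx) mulr0.
by apply: smoothM => //; exact: test_smooth.
Qed.

Lemma testD Omega v w : open Omega -> test_function Omega v -> test_function Omega w ->
  test_function Omega (fun x => v x + w x).
Proof.
move=> oO tv tw.
apply: (test_functionI oO (compactU (test_support_compact tv) (test_support_compact tw))).
- by rewrite subUset; split; [exact: test_support_sub tv|exact: test_support_sub tw].
- move=> x nx; rewrite !out_support0 ?addr0// => H; apply: nx; [by right|by left].
- by apply: smoothD => //; exact: test_smooth.
Qed.

Lemma test_pderiv Omega w i : open Omega -> test_function Omega w ->
  test_function Omega (pderiv i w).
Proof.
move=> oO tw; apply: (test_functionI oO (test_support_compact tw) (test_support_sub tw)).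
  move=> x; apply: vanishing_pderiv0; first exact: closed_closure.
  exact: out_support0.
by apply: smooth_pderiv; exact: test_smooth.
Qed.

Lemma test0 Omega : open Omega -> test_function Omega (fun=> 0).
Proof.
move=> oO; apply: (@test_functionI Omega set0) => //; first exact: compact0.
exact: smooth_cst.
Qed.

Lemma test_sum Omega (I : finType) (F : I -> E -> R) : open Omega ->
  (forall k, test_function Omega (F k)) -> test_function Omega (fun x => \sum_k F k x).
Proof.
move=> oO tF; elim: (index_enum I) => [|k s IH].
  rewrite (_ : (fun _ => _) = (fun=> 0)); first exact: test0.
  by apply/funext => x; rewrite big_nil.
rewrite (_ : (fun _ => _) = (fun x => F k x + \sum_(j <- s) F j x)).
  exact: testD.
by apply/funext => x; rewrite big_cons.
Qed.

Lemma test_cube Omega w : test_function Omega w ->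
  exists2 M, 0 < M & forall x, ~ cube M x -> w x = 0.
Proof.
move=> tw; have [M M0 KM] := bounded_set_cube (compact_bounded (test_support_compact tw)).
by exists M => // x nx; apply: out_support0 => /KM.
Qed.

Lemma test_integrable Omega D w : measurable D -> test_function Omega w ->
  leb.-integrable D (EFin \o w).
Proof.
move=> mD tw; have [M _ w0] := test_cube tw.
exact: (cube_supported_integrable mD (test_continuous tw) w0).
Qed.

(** The source of all integrations by parts below: a test function is defined on
    the whole space and vanishes near the complement of Omega, so there is no
    boundary term. *)
Lemma test_integral_pderiv Omega w i : open Omega -> test_function Omega w ->
  \int[leb]_(x in Omega) pderiv i w x = 0.
Proof.
move=> oO tw; have [M M0 w0] := test_cube tw.
have tp := test_pderiv i oO tw.
rewrite Rintegral_mkcond (_ : _ \_ _ = pderiv i w).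
  rewrite /Rintegral (integral_pderiv_eq0 M0)//.
  - by move=> x; apply: diff_derivable; exact: test_differentiable tw.
  - exact: test_continuous tp.
apply/funext => x; rewrite patchE; case: ifPn => //; rewrite notin_setE => nx.
by rewrite out_support0// => /(test_support_sub tp).
Qed.

Lemma test_integralD Omega v w : open Omega -> test_function Omega v ->
  test_function Omega w ->
  \int[leb]_(x in Omega) (v x + w x) =
  \int[leb]_(x in Omega) v x + \int[leb]_(x in Omega) w x.
Proof.
move=> oO tv tw; have mO := row_open_measurable oO.
by apply: RintegralD => //; apply: test_integrable; eauto.
Qed.

Lemma test_integralZ Omega (a : R) w : open Omega -> test_function Omega w ->
  \int[leb]_(x in Omega) (a * w x) = a * \int[leb]_(x in Omega) w x.
Proof.
move=> oO tw; have mO := row_open_measurable oO.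
by apply: RintegralZl => //; apply: test_integrable tw.
Qed.

Lemma test_integral_sum Omega (I : finType) (F : I -> E -> R) : open Omega ->
  (forall k, test_function Omega (F k)) ->
  \int[leb]_(x in Omega) (\sum_k F k x) = \sum_k \int[leb]_(x in Omega) F k x.
Proof.
move=> oO tF.
suff [_] : test_function Omega (fun x => \sum_k F k x) /\
    \int[leb]_(x in Omega) (\sum_k F k x) = \sum_k \int[leb]_(x in Omega) F k x by [].
elim: (index_enum I) => [|k s [ts IH]].
  rewrite (_ : (fun x => \sum_(_ <- _) _) = (fun=> 0)); last first.
    by apply/funext => x; rewrite big_nil.
  split; first exact: test0.
  by rewrite big_nil Rintegral_cst ?mul0r//; exact: row_open_measurable.
rewrite (_ : (fun x => \sum_(_ <- _ :: _) _) = (fun x => F k x + \sum_(j <- s) F j x)).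
  by split; [exact: testD|rewrite test_integralD// big_cons IH].
by apply/funext => x; rewrite big_cons.
Qed.

End test_functions.

(** * Bump functions *)

Section flat_functions.
Context {R : realType}.

(** For P = 1 this is the classical function exp(-1/t) that vanishes to infinite
    order at 0; the polynomial factor makes the family stable under derivation. *)
Definition flat (P : {poly R}) (t : R) : R :=
  if 0 < t then P.[t^-1] * expR (- t^-1) else 0.

(** Each monomial satisfies y^k <= k! exp y, by the exponential series. *)
Lemma poly_expR_bounded (Q : {poly R}) :
  exists2 C, 0 < C & forall y : R, 0 < y -> `|Q.[y] * expR (- y)| <= C.
Proof.
exists (\sum_(i < size Q) `|Q`_i| * i`!%:R + 1).
  by rewrite ltr_pwDr// sumr_ge0// => i _; rewrite mulr_ge0.
move=> y y0; rewrite horner_coef mulr_suml.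
apply: (le_trans (ler_norm_sum _ _ _)).
rewrite -[leLHS]addr0 lerD//; apply: ler_sum => i _.
rewrite -mulrA normrM ler_wpM2l//.
rewrite ger0_norm; last by rewrite mulr_ge0 ?expR_ge0// exprn_ge0// ltW.
rewrite expRN ler_pdivrMr ?expR_gt0//.
case: (nat_of_ord i) => [|k].
  by rewrite expr0 fact0 mul1r; apply: le_trans (expR_ge1Dx y); lra.
have := @expR_ge1Dxn R y k (ltW y0) => H.
rewrite mulrC -ler_pdivrMr; last by rewrite ltr0n fact_gt0.
by apply: le_trans H; rewrite lerDr.
Qed.

Lemma derive_quadratic_bound (f : R -> R) C : f 0 = 0 ->
  (forall h, `|f h| <= C * h ^+ 2) -> is_derive (0 : R) 1 f 0.
Proof.
move=> f0 fC.
have L : (fun h : R => h^-1 *: ((f \o shift 0) (h *: 1) - f 0)) @ 0^' --> (0 : R).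
  apply/cvgr0Pnorm_lt => e e0; near=> h.
  have h0 : h != 0 by near: h; exact: nbhs_dnbhs_neq.
  rewrite /= f0 subr0 addr0 /GRing.scale /= mulr1 normrM normfV.
  rewrite ltr_pdivrMl ?normr_gt0//; apply: (le_lt_trans (fC h)).
  rewrite -real_normK ?num_real// expr2 mulrCA ltr_pM2l ?normr_gt0//.
  rewrite (@le_lt_trans _ _ (`|C| * `|h|))//; first by rewrite ler_wpM2r ?ler_norm.
  rewrite (@le_lt_trans _ _ ((`|C| + 1) * `|h|))//; first by rewrite ler_wpM2r// lerDl.
  rewrite -ltr_pdivlMl ?ltr_pwDr//; near: h.
  have d0 : 0 < (`|C| + 1)^-1 * e by rewrite mulr_gt0// invr_gt0 ltr_pwDr.
  exact: dnbhs0_lt.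
split; last by exact: cvg_lim L.
by apply/cvg_ex; exists 0.
Unshelve. all: by end_near. Qed.

(** For t > 0 the factor X^2 is 1/t^2, the derivative of -1/t; it comes with P from
    the exponential and with -P' from the inner function. At 0, the bound of [poly_expR_bounded] for X^2 P gives [flat P t = O(t^2)]. *)
Lemma flat_derive (P : {poly R}) (t : R) :
  is_derive t 1 (flat P) (flat ('X^2 * (P - P^`())) t).
Proof.
have [t0|t0|t0] := ltgtP t 0.
- have -> : flat ('X^2 * (P - P^`())) t = 0 by rewrite /flat ltNge ltW.
  apply: (@near_eq_is_derive _ _ _ (cst 0)).
  near=> y; rewrite /flat ifF//; apply/negbTE; rewrite -leNgt ltW//.
  by near: y; exact: lt_nbhsl.
- pose F (y : R) := P.[y^-1] * expR (- y^-1).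
  apply: (@near_eq_is_derive _ _ _ F).
    by near=> y; rewrite /flat /F ifT//; near: y; exact: lt_nbhsr.
  have dV : is_derive t 1 (fun y : R => y^-1) (- (t^-1 * t^-1)).
    have [d e] := derive1_inv (lt0r_neq0 t0).
    by split => //; rewrite -derive1E.
  have dP : is_derive t 1 (fun y : R => P.[y^-1]) (P^`().[t^-1] * - (t^-1 * t^-1)).
    have dh : is_derive (t^-1) 1 (horner P) (P^`().[t^-1]).
      by split; [exact: derivable_horner|rewrite derivE derive1E].
    have := is_derive1_comp dh dV.
    by rewrite /GRing.scale/= mulrC.
  have dE : is_derive t 1 (fun y : R => expR (- y^-1)) (expR (- t^-1) * (t^-1 * t^-1)).
    have dN : is_derive t 1 (fun y : R => - y^-1) (t^-1 * t^-1).
      by apply: is_derive_eq; rewrite opprK.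
    have := @is_derive1_comp _ expR (fun y : R => - y^-1) t _ _ (is_derive_expR (- t^-1)) dN.
    by rewrite /GRing.scale/= mulrC.
  rewrite /flat t0 /F; apply: is_derive_eq.
  rewrite /GRing.scale /= hornerM hornerXn hornerD hornerN; ring.
- rewrite t0 /flat ltxx.
  have [C C0 HC] := poly_expR_bounded ('X^2 * P).
  apply: (@derive_quadratic_bound _ C); first by rewrite ltxx.
  move=> h; case: ifPn => h0; last by rewrite normr0 mulr_ge0 ?sqr_ge0 ?(ltW C0).
  have := HC h^-1; rewrite invr_gt0 h0 => /(_ isT).
  rewrite hornerM hornerXn -mulrA normrM exprVn normfV ler_pdivrMl.
    by rewrite [X in _ <= X]mulrC [`|h ^+ 2|]ger0_norm ?sqr_ge0.
  by rewrite normr_gt0 expf_neq0// lt0r_neq0.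
Unshelve. all: by end_near. Qed.

Lemma flat_ge0 t : 0 <= flat 1 t.
Proof. by rewrite /flat; case: ifP => // _; rewrite hornerC mul1r expR_ge0. Qed.

Lemma flat_gt0 t : 0 < t -> 0 < flat 1 t.
Proof. by move=> t0; rewrite /flat t0 hornerC mul1r expR_gt0. Qed.

Lemma flat_eq0 t : t <= 0 -> flat 1 t = 0.
Proof. by move=> t0; rewrite /flat ltNge t0. Qed.

End flat_functions.

Section bump_functions.
Context {R : realType} {n : nat}.
Local Notation E := 'rV[R]_n.

Lemma pderiv_coord (i j : 'I_n) (x : E) :
  pderiv j (fun y : E => y 0 i) x = (i == j)%:R.
Proof.
rewrite /pderiv (@derive_line_eq _ E R _ (fun t : R => t *: (i == j)%:R + x 0 i) x _ 0 1).
  by rewrite derive_val scale0r add0r addr0 /GRing.scale/= mulr1.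
by move=> s; rewrite !mxE eqxx /= addr0 /GRing.scale/= mulr1.
Qed.

Lemma differentiable_affine_coord (i : 'I_n) (c s : R) (x : E) :
  differentiable (fun y : E => c + s * y 0 i) x.
Proof.
apply: differentiableDf; first exact: differentiable_cst.
apply: differentiableMf; first exact: differentiable_cst.
exact: differentiable_coord.
Qed.

Lemma pderiv_affine_coord (i j : 'I_n) (c s : R) (x : E) :
  pderiv j (fun y : E => c + s * y 0 i) x = s * (i == j)%:R.
Proof.
rewrite pderivD; first last.
- apply: differentiableMf; [exact: differentiable_cst|exact: differentiable_coord].
- exact: differentiable_cst.
rewrite pderivM; first last.
- exact: differentiable_coord.
- exact: differentiable_cst.
by rewrite !pderiv_cst pderiv_coord mulr0 addr0 add0r.
Qed.

(** Up to scalar factors, the derivatives of such a function are functions of the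
    same form with another polynomial, so [smooth_coind] applies. *)
Lemma smooth_flat (P : {poly R}) (c s : R) (i : 'I_n) :
  smooth_on [set: E] (fun x => flat P (c + s * x 0 i)).
Proof.
pose C (f : E -> R) := exists a (P : {poly R}), f = fun x => a * flat P (c + s * x 0 i).
have dF (Q : {poly R}) x : differentiable (fun x : E => flat Q (c + s * x 0 i)) x.
  apply: differentiable_comp1; first exact: differentiable_affine_coord.
  by case: (flat_derive Q (c + s * x 0 i)).
apply: (@smooth_coind _ _ _ C); first exact: openT.
- move=> _ [a [Q ->]] x _; apply: differentiableMf => //; exact: differentiable_cst.
- move=> _ j [a [Q ->]].
  exists (fun x => (a * (s * (i == j)%:R)) * flat ('X^2 * (Q - Q^`())) (c + s * x 0 i)).
    by exists (a * (s * (i == j)%:R)), ('X^2 * (Q - Q^`())).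
  move=> x _; rewrite pderivM; first last.
  + exact: dF.
  + exact: differentiable_cst.
  have [d e] := flat_derive Q (c + s * x 0 i).
  rewrite pderiv_cst mulr0 addr0 (@pderiv_comp _ _ _ (flat Q)); first last.
  + exact: d.
  + exact: differentiable_affine_coord.
  by rewrite derive1E e pderiv_affine_coord; ring.
- by exists 1, P; apply/funext => x; rewrite mul1r.
Qed.

(** A product over the coordinates of two flat functions, one vanishing for
    x_i >= p_i + r and the other for x_i <= p_i - r: the support is a cube. *)
Definition bump (p : E) (r : R) (x : E) : R :=
  \prod_(i < n) (flat 1 ((r + p 0 i) + (-1) * x 0 i) * flat 1 ((r - p 0 i) + 1 * x 0 i)).

Lemma bump_smooth p r : smooth_on [set: E] (bump p r).
Proof.
have oT := @openT E.
rewrite /bump; elim: (index_enum _) => [|k s IH].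
  rewrite (_ : (fun _ => _) = (fun=> 1)); first exact: smooth_cst.
  by apply/funext => x; rewrite big_nil.
pose g (x : E) := flat 1 ((r + p 0 k) + (-1) * x 0 k) * flat 1 ((r - p 0 k) + 1 * x 0 k).
rewrite (_ : (fun _ => _) = (fun x => g x * \prod_(i <- s)
   (flat 1 ((r + p 0 i) + (-1) * x 0 i) * flat 1 ((r - p 0 i) + 1 * x 0 i)))).
  by apply: smoothM => //; apply: smoothM => //; exact: smooth_flat.
by apply/funext => x; rewrite big_cons.
Qed.

Lemma bump_ge0 (p : E) (r : R) (x : E) : 0 <= bump p r x.
Proof. by apply: prodr_ge0 => i _; rewrite mulr_ge0 ?flat_ge0. Qed.

Lemma bump_gt0 (p : E) (r : R) : 0 < r -> 0 < bump p r p.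
Proof. by move=> r0; apply: prodr_gt0 => i _; rewrite mulr_gt0// flat_gt0//; lra. Qed.

Lemma bump_eq0 (p : E) (r : R) (x : E) (i : 'I_n) : r <= `|p 0 i - x 0 i| -> bump p r x = 0.
Proof.
rewrite ler_normr => H; rewrite /bump (bigD1 i)//=.
by case/orP: H => H; [rewrite [X in _ * X * _]flat_eq0 ?mulr0 ?mul0r|rewrite [X in X * _ * _]flat_eq0 ?mul0r]; lra.
Qed.

Lemma bump_test (Omega : set E) (p : E) (r : R) : 0 < r -> open Omega ->
  [set x : E | forall i, `|p 0 i - x 0 i| <= r] `<=` Omega ->
  test_function Omega (bump p r).
Proof.
move=> r0 oO KO; apply: (test_functionI (K := [set x : E | forall i, `|p 0 i - x 0 i| <= r])) => //.
- have -> : [set x : E | forall i, `|p 0 i - x 0 i| <= r] =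
    [set x | forall i, [set` `[p 0 i - r, p 0 i + r]] (x ord0 i)].
    apply/seteqP; split => x /= H i; have := H i;
      by rewrite in_itv/= ler_norml => /andP[? ?]; apply/andP; split; lra.
  by apply: (@rV_compact _ _ (fun i => [set` `[p 0 i - r, p 0 i + r]])) => i; exact: segment_compact.
- move=> x /= /existsNP[i /negP]; rewrite -ltNge => /ltW; exact: bump_eq0.
- by apply: smooth_on_subset (bump_smooth p r); exact: subsetT.
Qed.

End bump_functions.

(** * The fundamental lemma of the calculus of variations *)

Section fundamental_lemma.
Context {R : realType} {n : nat}.
Local Notation E := 'rV[R]_n.
Local Notation leb := (lebesgue_row n).

(** If f p > 0, then f times a bump function at p is nonnegative and bounded below
    by a positive constant on a ball, which has positive measure. *)
Lemma test_integral0_le0 (Omega : set E) (f : E -> R) (p : E) :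
  open Omega -> (forall x, Omega x -> {for x, continuous f}) ->
  (forall w, test_function Omega w ->
    leb.-integrable Omega (EFin \o (fun x => f x * w x)) /\
    \int[leb]_(x in Omega) (f x * w x) = 0) ->
  Omega p -> f p <= 0.
Proof.
move=> oO cf f0 Op; rewrite leNgt; apply/negP => fp.
have fp2 : 0 < f p / 2 by rewrite divr_gt0.
have [r /= r0 rO] : nbhs_ball p [set x | Omega x /\ f p / 2 < f x].
  apply/nbhs_ballP; have : nbhs p Omega by exact: open_nbhs_nbhs.
  have /cvgrPdist_lt/(_ _ fp2) := cf p Op.
  apply: filterS2 => x; rewrite ltr_norml => /andP[_ H] Ox; split => //; lra.
have r20 : 0 < r / 2 by rewrite divr_gt0.
pose w := bump p (r / 2).
have KO : [set x : E | forall i, `|p 0 i - x 0 i| <= r / 2] `<=` Omega.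
  move=> x xr; apply: (rO x _).1; rewrite ball_rowE// => i.
  by rewrite (le_lt_trans (xr i))//; lra.
have tw : test_function Omega w by exact: bump_test.
have wp : 0 < w p by exact: bump_gt0.
have fw0 x : 0 <= f x * w x.
  have [xr|/existsNP[i /negP]] := pselect (forall i, `|p 0 i - x 0 i| < r / 2).
    apply: mulr_ge0; last exact: bump_ge0.
    have [|_ fx] := rO x; last by apply: ltW; apply: lt_trans fx.
    by rewrite ball_rowE// => i; rewrite (lt_trans (xr i))//; lra.
  by rewrite -leNgt /w => /bump_eq0 ->; rewrite mulr0.
have wp2 : 0 < w p / 2 by rewrite divr_gt0.
have [q /= q0 qO] : nbhs_ball p [set x | Omega x /\ f p / 2 * (w p / 2) <= f x * w x].
  apply/nbhs_ballP.
  have /cvgrPdist_lt/(_ _ wp2) : {for p, continuous w} by exact: (test_continuous tw).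
  have : nbhs p [set x | Omega x /\ f p / 2 < f x] by apply/nbhs_ballP; exists r.
  apply: filterS2 => x [Ox fx]; rewrite ltr_norml => /andP[_ H]; split => //.
  by apply: ler_pM; rewrite ?ltW//; lra.
have mO := row_open_measurable oO.
have mq := measurable_row_ball p q0.
have [iw Iw] := f0 w tw.
have : (0 < \int[leb]_(x in Omega) (f x * w x)%:E)%E.
  have qsub : ball p q `<=` Omega by move=> x /qO[].
  have mfw : measurable_fun Omega (EFin \o (fun x => f x * w x)) by case/integrableP: iw.
  apply: (@lt_le_trans _ _ (\int[leb]_(x in ball p q) (f x * w x)%:E)%E); last first.
    by apply: ge0_subset_integral => // x _; rewrite lee_fin.
  apply: (@lt_le_trans _ _ (\int[leb]_(x in ball p q) (f p / 2 * (w p / 2))%:E)%E).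
    rewrite integral_cst// mule_gt0 ?lte_fin ?mulr_gt0//.
    exact: lebesgue_ball_gt0.
  apply: ge0_le_integral => //.
  - by move=> x _; rewrite lee_fin mulr_ge0// ltW.
  - exact: (measurable_funS mO qsub mfw).
  - by move=> x /qO[_]; rewrite lee_fin.
move: Iw; rewrite /Rintegral => Iw.
have fin := integrable_fin_num mO iw.
by rewrite -(fineK fin) Iw ltxx.
Qed.

Lemma test_integral_eq0 (Omega : set E) (f : E -> R) (p : E) :
  open Omega -> (forall x, Omega x -> {for x, continuous f}) ->
  (forall w, test_function Omega w ->
    leb.-integrable Omega (EFin \o (fun x => f x * w x)) /\
    \int[leb]_(x in Omega) (f x * w x) = 0) ->
  Omega p -> f p = 0.
Proof.
move=> oO cf f0 Op; apply/eqP; rewrite eq_le (test_integral0_le0 oO cf f0 Op)/=.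
rewrite -oppr_le0; apply: (@test_integral0_le0 Omega (fun x => - f x) p oO) => //.
  by move=> x Ox; apply: continuousN; exact: cf.
move=> w tw; have [iw Iw] := f0 w tw; have mO := row_open_measurable oO.
have -> : (fun x => - f x * w x) = (fun x => -1 * (f x * w x)).
  by apply/funext => x; rewrite mulN1r mulNr.
split; last by rewrite RintegralZl// Iw mulr0.
have -> : EFin \o (fun x => -1 * (f x * w x)) = (fun x => (-1)%:E * (EFin \o (fun x => (f x * w x)%R)) x)%E.
  by apply/funext => x.
exact: integrableZl.
Qed.

End fundamental_lemma.

(** * Uniform first-order expansions *)

Section first_order_expansion.
Context {R : realType} {n : nat}.
Local Notation E := 'rV[R]_n.
Implicit Types (K : set E) (F G : R -> E -> R) (a b : E -> R).

(** A first-order calculus in s that survives integration over K, because the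
    remainder is uniform; it replaces differentiation under the integral sign. A
    single constant serves both as the bound and as the inverse of the range
    allowed for s; it can only be enlarged ([expands_weaken]), so two expansions
    can always be given the same constant. *)
Definition expands K F a b := exists2 C, 1 <= C &
  forall s x, `|s| <= C^-1 -> K x ->
    [/\ `|a x| <= C, `|b x| <= C & `|F s x - a x - s * b x| <= C * s ^+ 2].

Lemma expands_weaken K F a b C C' : 1 <= C -> C <= C' ->
  (forall s x, `|s| <= C^-1 -> K x ->
    [/\ `|a x| <= C, `|b x| <= C & `|F s x - a x - s * b x| <= C * s ^+ 2]) ->
  (forall s x, `|s| <= C'^-1 -> K x ->
    [/\ `|a x| <= C', `|b x| <= C' & `|F s x - a x - s * b x| <= C' * s ^+ 2]).
Proof.
move=> C1 CC H s x sC Kx.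
have [|aC bC FC] := H s x _ Kx.
  by apply: (le_trans sC); rewrite lef_pV2// posrE; lra.
split; [exact: le_trans aC CC|exact: le_trans bC CC|].
by apply: (le_trans FC); rewrite ler_wpM2r// sqr_ge0.
Qed.

Lemma inv_le1 (C : R) : 1 <= C -> C^-1 <= 1.
Proof. by move=> C1; rewrite invf_le1//; lra. Qed.

Lemma expands_affine K a b : (exists M, forall x, K x -> `|a x| <= M) ->
  (exists M, forall x, K x -> `|b x| <= M) ->
  expands K (fun s x => a x + s * b x) a b.
Proof.
move=> [M1 H1] [M2 H2]; exists (1 + `|M1| + `|M2|).
  by rewrite -addrA lerDl addr_ge0.
move=> s x _ Kx; split.
- apply: (le_trans (H1 x Kx)); have := ler_norm M1; have := normr_ge0 M2; lra.
- apply: (le_trans (H2 x Kx)); have := ler_norm M2; have := normr_ge0 M1; lra.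
- rewrite (_ : _ - _ = 0) ?normr0; last by ring.
  by rewrite mulr_ge0 ?sqr_ge0// !addr_ge0.
Qed.

Lemma expandsD K F G a b c d : expands K F a b -> expands K G c d ->
  expands K (fun s x => F s x + G s x) (fun x => a x + c x) (fun x => b x + d x).
Proof.
move=> [C1 C11 H1] [C2 C21 H2].
exists (C1 + C2) => [|s x sC Kx]; first by lra.
have sC1 : `|s| <= C1^-1 by apply: (le_trans sC); rewrite lef_pV2// ?posrE; lra.
have sC2 : `|s| <= C2^-1 by apply: (le_trans sC); rewrite lef_pV2// ?posrE; lra.
have [aC bC FC] := H1 s x sC1 Kx; have [cC dC GC] := H2 s x sC2 Kx.
split; [exact: le_trans (ler_normD _ _) (lerD aC cC)|exact: le_trans (ler_normD _ _) (lerD bC dC)|].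
rewrite (_ : _ - _ = (F s x - a x - s * b x) + (G s x - c x - s * d x)); last by ring.
by rewrite mulrDl; apply: le_trans (ler_normD _ _) (lerD FC GC).
Qed.

Lemma expandsM K F G a b c d : expands K F a b -> expands K G c d ->
  expands K (fun s x => F s x * G s x) (fun x => a x * c x)
    (fun x => a x * d x + b x * c x).
Proof.
move=> [C1 C11 H1'] [C2 C21 H2'].
pose C := C1 + C2; have C1' : 1 <= C by rewrite /C; lra.
have H1 := @expands_weaken K F a b C1 C C11 ltac:(rewrite /C; lra) H1'.
have H2 := @expands_weaken K G c d C2 C C21 ltac:(rewrite /C; lra) H2'.
have CC : C <= C ^+ 2 by rewrite expr2 ler_peMl//; lra.
exists (6 * C ^+ 2) => [|s x sC Kx]; first by lra.
have sC1 : `|s| <= C^-1 by apply: (le_trans sC); rewrite lef_pV2// ?posrE; lra.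
have s1 : `|s| <= 1 := le_trans sC1 (inv_le1 C1').
have [aC bC FC] := H1 s x sC1 Kx; have [cC dC GC] := H2 s x sC1 Kx.
have M (u v : R) : `|u| <= C -> `|v| <= C -> `|u * v| <= C ^+ 2.
  by move=> uC vC; rewrite normrM expr2 ler_pM.
have [ac ad bc bd] := And4 (M _ _ aC cC) (M _ _ aC dC) (M _ _ bC cC) (M _ _ bC dC).
have s2 : 0 <= s ^+ 2 by exact: sqr_ge0.
have s2' : s ^+ 2 <= 1 by rewrite -real_normK ?num_real// expr_le1.
split; first by lra.
  by apply: (le_trans (ler_normD _ _)); lra.
set r1 := F s x - a x - s * b x in FC.
set r2 := G s x - c x - s * d x in GC.
rewrite (_ : _ - _ = s ^+ 2 * (b x * d x) + r1 * (c x + s * d x + r2) + (a x + s * b x) * r2); last first.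
  by rewrite /r1 /r2; ring.
have S (u v : R) : `|u| <= C -> `|v| <= C -> `|u + s * v| <= 2 * C.
  move=> uC vC; apply: (le_trans (ler_normD _ _)).
  have : `|s * v| <= 1 * C by rewrite normrM ler_pM.
  lra.
have r2C : `|r2| <= C by apply: (le_trans GC); rewrite ler_piMr//; lra.
apply: (le_trans (ler_normD _ _)).
have T1 : `|(a x + s * b x) * r2| <= (2 * C) * (C * s ^+ 2) by rewrite normrM ler_pM// S.
have T2 : `|r1 * (c x + s * d x + r2)| <= (C * s ^+ 2) * (3 * C).
  rewrite normrM ler_pM//; apply: (le_trans (ler_normD _ _)).
  by have := S _ _ cC dC; lra.
have T3 : `|s ^+ 2 * (b x * d x)| <= s ^+ 2 * C ^+ 2.
  by rewrite normrM ler_pM// ger0_norm.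
have := ler_normD (s ^+ 2 * (b x * d x)) (r1 * (c x + s * d x + r2)).
have -> : 6 * C ^+ 2 * s ^+ 2 = s ^+ 2 * C ^+ 2 + C * s ^+ 2 * (3 * C) + 2 * C * (C * s ^+ 2).
  by ring.
lra.
Qed.

(** The remainder of the inverse is the quotient of a quantity O(s^2) by a^2 F, and
    F stays away from 0 for small s because a does. *)
Lemma expandsV K F a b : (exists M, forall x, K x -> `|(a x)^-1| <= M) ->
  (forall x, K x -> a x != 0) -> expands K F a b ->
  expands K (fun s x => (F s x)^-1) (fun x => (a x)^-1)
    (fun x => - b x * ((a x)^-1 * (a x)^-1)).
Proof.
move=> [M' HM'] a0 [C0 C01 H0].
pose C := C0 + `|M'|.
have M0 := normr_ge0 M'.
have C1 : 1 <= C by rewrite /C; lra.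
have H := @expands_weaken K F a b C0 C C01 ltac:(rewrite /C; lra) H0.
have HM x : K x -> `|(a x)^-1| <= C.
  by move=> Kx; apply: (le_trans (HM' x Kx)); have := ler_norm M'; rewrite /C; lra.
have C0' : 0 < C by lra.
have CC : 1 <= C ^+ 2 by rewrite expr_ge1// ltW.
have C4 k : C <= C ^+ k.+1 by rewrite exprS ler_peMr ?exprn_ege1// ltW.
exists (6 * C ^+ 5) => [|s x sC Kx]; first by have := C4 4%N; lra.
have sC1 : `|s| <= C^-1.
  by apply: (le_trans sC); rewrite lef_pV2// ?posrE; have := C4 4%N; lra.
have s1 : `|s| <= 1 := le_trans sC1 (inv_le1 C1).
have [aC bC FC] := H s x sC1 Kx; have aV := HM x Kx; have ax := a0 x Kx.
have s2 : 0 <= s ^+ 2 by exact: sqr_ge0.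
have sCC : `|s| * (4 * C ^+ 2) <= 1.
  have C25 : C ^+ 2 <= C ^+ 5 by exact: ler_weXn2l.
  rewrite -ler_pdivlMr; last by lra.
  by rewrite div1r (le_trans sC)// lef_pV2// ?posrE; lra.
have s2s : s ^+ 2 <= `|s| by rewrite -real_normK ?num_real// expr2 ler_piMl.
have aCV : C^-1 <= `|a x|.
  by rewrite -[`|a x|]invrK lef_pV2 ?posrE ?invr_gt0 ?normr_gt0// -normfV.
set r := F s x - a x - s * b x in FC.
have EF : F s x = a x + s * b x + r by rewrite /r; ring.
have Fa : `|F s x - a x| <= (2 * C) * `|s|.
  rewrite EF (_ : _ - _ = s * b x + r); last by ring.
  apply: (le_trans (ler_normD _ _)).
  have : `|s * b x| <= `|s| * C by rewrite normrM ler_pM.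
  have : C * s ^+ 2 <= C * `|s| by rewrite ler_pM2l.
  lra.
have sCV : 2 * C * `|s| <= C^-1 / 2.
  rewrite ler_pdivlMr// -(ler_pM2l C0') divff ?lt0r_neq0//.
  by rewrite (_ : _ * _ = `|s| * (4 * C ^+ 2))//; ring.
have Flow : C^-1 / 2 <= `|F s x|.
  have := ler_distD (F s x) (a x) 0; rewrite !subr0 distrC => D.
  have : C^-1 = C^-1 / 2 + C^-1 / 2 by rewrite -splitr.
  lra.
have CV0 : 0 < C^-1 by rewrite invr_gt0.
have F0 : F s x != 0 by rewrite -normr_gt0; lra.
have FV : `|(F s x)^-1| <= 2 * C.
  rewrite normfV -[2 * C]invrK lef_pV2 ?posrE ?normr_gt0 ?invr_gt0//; last by lra.
  by rewrite invfM mulrC.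
split.
- by apply: (le_trans aV); have := C4 4%N; lra.
- rewrite normrM normrN normrM.
  have T : `|b x| * (`|(a x)^-1| * `|(a x)^-1|) <= C * (C * C).
    by apply: ler_pM => //; apply: ler_pM.
  apply: (le_trans T).
  have : C ^+ 3 <= C ^+ 5 by exact: ler_weXn2l.
  have := C4 4%N; rewrite (_ : C ^+ 3 = C * (C * C)); last by ring.
  lra.
- rewrite (_ : _ - _ = (- (a x * r) + s ^+ 2 * (b x * b x) + s * b x * r) *
      ((a x)^-1 * (a x)^-1 * (F s x)^-1)); last first.
    have F0' := F0; rewrite EF in F0'; rewrite EF; field.
    by rewrite ax F0'.
  rewrite normrM.
  have T : `|(a x)^-1 * (a x)^-1 * (F s x)^-1| <= C * C * (2 * C).
    rewrite !normrM; apply: ler_pM => //; exact: ler_pM.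
  have S : `|- (a x * r) + s ^+ 2 * (b x * b x) + s * b x * r| <= 3 * C ^+ 2 * s ^+ 2.
    have S1 : `|- (a x * r)| <= C * (C * s ^+ 2) by rewrite normrN normrM ler_pM.
    have S2 : `|s ^+ 2 * (b x * b x)| <= s ^+ 2 * (C * C).
      by rewrite (normrM (s ^+ 2)) (ger0_norm s2) normrM ler_wpM2l// ler_pM.
    have S3 : `|s * b x * r| <= 1 * C * (C * s ^+ 2).
      by rewrite (normrM (s * b x)) (normrM s); do 2 apply: ler_pM => //.
    apply: (le_trans (ler_normD _ _)).
    have := ler_normD (- (a x * r)) (s ^+ 2 * (b x * b x)).
    rewrite (_ : 3 * C ^+ 2 * s ^+ 2 = C * (C * s ^+ 2) + s ^+ 2 * (C * C) + 1 * C * (C * s ^+ 2)); last by ring.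
    lra.
  apply: (le_trans (ler_pM _ _ S T)) => //.
  by rewrite (_ : 6 * C ^+ 5 * s ^+ 2 = 3 * C ^+ 2 * s ^+ 2 * (C * C * (2 * C))) //; ring.
Qed.

Lemma expands_eq K F G a b a' b' :
  (forall s x, K x -> F s x = G s x) -> (forall x, K x -> a x = a' x) ->
  (forall x, K x -> b x = b' x) -> expands K F a b -> expands K G a' b'.
Proof.
move=> FG aa bb [C C1 H]; exists C => // s x sC Kx.
by rewrite -FG// -aa// -bb//; exact: H.
Qed.

Lemma expands_sum K (I : finType) (F : I -> R -> E -> R) (a b : I -> E -> R) :
  (forall k, expands K (F k) (a k) (b k)) ->
  expands K (fun s x => \sum_k F k s x) (fun x => \sum_k a k x) (fun x => \sum_k b k x).
Proof.
move=> H; elim: (index_enum I) => [|k l IH].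
  by exists 1 => // s x _ _; rewrite !big_nil mulr0 !subr0 normr0 mul1r sqr_ge0.
have := expandsD (H k) IH; apply: expands_eq => [s|x|x] *; by rewrite big_cons.
Qed.

End first_order_expansion.

(** * Differentiating the integral of a square *)

Section integral_variation.
Context {R : realType} {n : nat}.
Local Notation E := 'rV[R]_n.
Local Notation leb := (lebesgue_row n).

Lemma bounded_lebesgue_lty (Omega : set E) : open Omega -> bounded_set Omega ->
  (leb Omega < +oo)%E.
Proof.
move=> oO /bounded_set_cube[M _ OM].
apply: le_lt_trans (lebesgue_cube_lty n M).
apply: le_measure => //; rewrite inE.
- exact: row_open_measurable.
- exact: measurable_cube.
Qed.

(** The remainder of the expansion of D^2 is bounded by C s^2 on K and vanishes on
    Omega outside K, and Omega has finite measure; so it contributes O(s) to the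
    difference quotient. The integral of D^2 itself over Omega is only assumed to
    be finite at s = 0. *)
Lemma integral_sq_variation (Omega K : set E) (D : R -> E -> R) (D1 : E -> R) :
  open Omega -> bounded_set Omega ->
  expands K D (D 0) D1 ->
  (forall s x, Omega x -> ~ K x -> D s x = D 0 x) ->
  (forall x, Omega x -> ~ K x -> D1 x = 0) ->
  (exists2 d, 0 < d & forall s x, `|s| <= d -> Omega x -> {for x, continuous (D s)}) ->
  (forall x, Omega x -> {for x, continuous D1}) ->
  leb.-integrable Omega (EFin \o (fun x => 2 * D 0 x * D1 x)) ->
  leb.-integrable Omega (EFin \o (fun x => D 0 x ^+ 2)) ->
  (\int[leb]_(x in Omega) (D s x ^+ 2) - \int[leb]_(x in Omega) (D 0 x ^+ 2)) / s
    @[s --> 0^'] --> \int[leb]_(x in Omega) (2 * D 0 x * D1 x).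
Proof.
move=> oO bO expD DK D1K [d d0 cD] cD1 iD1 iD0.
have mO := row_open_measurable oO.
have fO := bounded_lebesgue_lty oO bO.
have [C C1 HC] := expandsM expD expD.
pose r s x := D s x ^+ 2 - D 0 x ^+ 2 - s * (2 * D 0 x * D1 x).
have rC s x : `|s| <= C^-1 -> Omega x -> `|r s x| <= C * s ^+ 2.
  move=> sC Ox; have [Kx|nKx] := pselect (K x).
    have [_ _] := HC s x sC Kx; apply: le_trans.
    by rewrite /r !expr2 (_ : D 0 x * D1 x + D1 x * D 0 x = 2 * D 0 x * D1 x)//; ring.
  rewrite /r DK// D1K// mulr0 mulr0 subr0 subrr normr0 mulr_ge0 ?sqr_ge0//; lra.
have ir s : `|s| <= C^-1 -> `|s| <= d -> leb.-integrable Omega (EFin \o r s).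
  move=> sC sd; apply: measurable_bounded_integrable => //.
    apply: row_continuous_measurable => // x Ox.
    have c0 : {for x, continuous (D 0)} by apply: cD => //; rewrite normr0 ltW.
    have cs : {for x, continuous (D s)} by exact: cD.
    have c1 := cD1 x Ox.
    have cM (f g : E -> R) : {for x, continuous f} -> {for x, continuous g} ->
      {for x, continuous (fun y => f y * g y)} by move=> cf cg; exact: (continuousM cf cg).
    have cB (f g : E -> R) : {for x, continuous f} -> {for x, continuous g} ->
      {for x, continuous (fun y => f y - g y)} by move=> cf cg; exact: (continuousB cf cg).
    have cC (a : R) : {for x, continuous (fun=> a : R)} by exact: cst_continuous.
    apply: (cB); last by apply: (cM) => //; apply: (cM) => //; apply: (cM).
    by apply: (cB); apply: (cM).
  exists (C * s ^+ 2); split; first exact: num_real.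
  by move=> M CM x Ox; apply: le_trans (ltW CM); exact: rC.
have Er s : `|s| <= C^-1 -> `|s| <= d ->
    \int[leb]_(x in Omega) (D s x ^+ 2) = \int[leb]_(x in Omega) (D 0 x ^+ 2) +
    s * \int[leb]_(x in Omega) (2 * D 0 x * D1 x) + \int[leb]_(x in Omega) r s x.
  move=> sC sd.
  have isD1 : leb.-integrable Omega (EFin \o (fun x => s * (2 * D 0 x * D1 x))).
    rewrite (_ : EFin \o _ = (fun x => s%:E * (EFin \o (fun x => (2 * D 0 x * D1 x)%R)) x)%E)//.
    exact: integrableZl.
  have isum : leb.-integrable Omega (EFin \o (fun x => D 0 x ^+ 2 + s * (2 * D 0 x * D1 x))).
    exact: (integrableD mO iD0 isD1).
  rewrite -(RintegralZl s mO iD1) -(RintegralD mO iD0 isD1) -(RintegralD mO isum (ir s sC sd)).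
  by apply: eq_Rintegral => x _; rewrite /r; ring.
have Br s : `|s| <= C^-1 -> `|s| <= d ->
    `|\int[leb]_(x in Omega) r s x| <= C * s ^+ 2 * fine (leb Omega).
  move=> sC sd; apply: (le_trans (le_normr_Rintegral mO (ir s sC sd))).
  rewrite -Rintegral_cst//; apply: le_Rintegral => //.
  - exact: (integrable_norm (ir s sC sd)).
  - apply: measurable_bounded_integrable => //.
    exists `|C * s ^+ 2|; split; first exact: num_real.
    by move=> M CM x Ox; exact: ltW.
  - by move=> x Ox; exact: rC.
apply/cvgrPdist_lt => e e0.
have m0 : 0 <= fine (leb Omega) by exact: fine_ge0.
have C0 : 0 < C by lra.
have P : 0 < C * fine (leb Omega) + 1 by rewrite ltr_pwDr// mulr_ge0// ltW.
have P' : 0 < (C * fine (leb Omega) + 1)^-1 * e by rewrite mulr_gt0// invr_gt0.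
near=> s.
have s0 : s != 0 by near: s; exact: nbhs_dnbhs_neq.
have sC : `|s| <= C^-1.
  by apply: ltW; near: s; apply: dnbhs0_lt; rewrite invr_gt0; lra.
have sd : `|s| <= d by apply: ltW; near: s; exact: dnbhs0_lt.
rewrite Er// [X in X / s](_ : _ = s * \int[leb]_(x in Omega) (2 * D 0 x * D1 x) +
   \int[leb]_(x in Omega) r s x); last by ring.
rewrite mulrDl mulrAC divff// mul1r opprD addNKr normrN normrM normfV.
rewrite ltr_pdivrMr ?normr_gt0//; apply: (le_lt_trans (Br s sC sd)).
rewrite -real_normK ?num_real// expr2 mulrA mulrAC ltr_pM2r ?normr_gt0//.
rewrite mulrAC.
apply: (@le_lt_trans _ _ ((C * fine (leb Omega) + 1) * `|s|)).
  by rewrite ler_wpM2r// lerDl.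
rewrite -ltr_pdivlMl//; near: s; exact: dnbhs0_lt P'.
Unshelve. all: by end_near. Qed.

End integral_variation.

(** * Derivatives of the double well *)

Section double_well_derivatives.
Context {R : realType}.

Lemma derive1_double_well : derive1 (@double_well R) =
  (fun s => s - 3 * (s * s) + 2 * (s * (s * s))).
Proof.
apply/funext => s; rewrite derive1E.
have -> : @double_well R = (fun s => s * s * (2^-1 * ((1 - s) * (1 - s)))).
  by apply/funext => t; rewrite /double_well; ring.
by rewrite derive_val /GRing.scale/=; field.
Qed.

Lemma derive2_double_well : derive1n 2 (@double_well R) =
  (fun s => 1 - 6 * s + 6 * (s * s)).
Proof.
apply/funext => s; rewrite /derive1n/= derive1_double_well derive1E.
rewrite derive_val /GRing.scale/=; ring.
Qed.

End double_well_derivatives.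

(** * Integration by parts *)

Section integration_by_parts.
Context {R : realType} {n : nat}.
Local Notation E := 'rV[R]_n.
Local Notation leb := (lebesgue_row n).

Lemma pderiv_sum (I : finType) (F : I -> E -> R) i x :
  (forall k, differentiable (F k) x) ->
  pderiv i (fun y => \sum_k F k y) x = \sum_k pderiv i (F k) x.
Proof.
move=> dF.
suff [_] : differentiable (fun y => \sum_k F k y) x /\
    pderiv i (fun y => \sum_k F k y) x = \sum_k pderiv i (F k) x by [].
elim: (index_enum I) => [|k s [ds IH]].
  rewrite (_ : (fun y => \sum_(_ <- _) _) = (fun=> 0)); last first.
    by apply/funext => y; rewrite big_nil.
  by rewrite big_nil pderiv_cst; split => //; exact: differentiable_cst.
rewrite (_ : (fun y => \sum_(_ <- _ :: _) _) = (fun y => F k y + \sum_(j <- s) F j y)).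
  by split; [exact: differentiableDf|rewrite pderivD// big_cons IH].
by apply/funext => y; rewrite big_cons.
Qed.

Lemma pderivZ i (a : R) (f : E -> R) x : differentiable f x ->
  pderiv i (fun y => a * f y) x = a * pderiv i f x.
Proof.
by move=> df; rewrite pderivM ?pderiv_cst ?mulr0 ?addr0//; exact: differentiable_cst.
Qed.

Lemma test_by_parts (Omega : set E) (f w : E -> R) i : open Omega ->
  smooth_on Omega f -> test_function Omega w ->
  \int[leb]_(x in Omega) (f x * pderiv i w x) =
  \int[leb]_(x in Omega) (- pderiv i f x * w x).
Proof.
move=> oO sf tw; apply/eqP; rewrite -subr_eq0; apply/eqP.
have tw' := test_pderiv i oO tw.
have mO := row_open_measurable oO.
have sf' := smoothN oO (smooth_pderiv i sf).
rewrite -RintegralB//; first last.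
- exact: (test_integrable mO (testMl oO sf' tw)).
- exact: (test_integrable mO (testMl oO sf tw')).
rewrite -(test_integral_pderiv i oO (testMl oO sf tw)).
apply: eq_Rintegral => x; rewrite inE => Ox.
rewrite pderivM; first by ring.
- exact: smooth_differentiable Ox.
- exact: (test_differentiable _ tw).
Qed.

Lemma test_by_parts2 (Omega : set E) (f w : E -> R) i j : open Omega ->
  smooth_on Omega f -> test_function Omega w ->
  \int[leb]_(x in Omega) (f x * pderiv i (pderiv j w) x) =
  \int[leb]_(x in Omega) (pderiv j (pderiv i f) x * w x).
Proof.
move=> oO sf tw; rewrite (test_by_parts i oO sf (test_pderiv j oO tw)).
have sf' := smoothN oO (smooth_pderiv i sf).
rewrite (test_by_parts j oO sf' tw); apply: eq_Rintegral => x; rewrite inE => Ox.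
congr (_ * _).
have -> : (fun x => - pderiv i f x) = (fun x => (-1) * pderiv i f x).
  by apply/funext => y; rewrite mulN1r.
rewrite pderivZ ?mulN1r ?opprK//.
exact: (smooth_differentiable (smooth_pderiv i sf) Ox).
Qed.

Lemma test_by_parts_operator (Omega : set E) (A : 'I_n -> 'I_n -> E -> R)
    (b : 'I_n -> E -> R) (c w : E -> R) : open Omega ->
  (forall i j, smooth_on Omega (A i j)) -> (forall i, smooth_on Omega (b i)) ->
  smooth_on Omega c -> test_function Omega w ->
  \int[leb]_(x in Omega) (\sum_i \sum_j A i j x * pderiv i (pderiv j w) x +
     \sum_i b i x * pderiv i w x + c x * w x) =
  \int[leb]_(x in Omega) ((\sum_i \sum_j pderiv j (pderiv i (A i j)) x -
     \sum_i pderiv i (b i) x + c x) * w x).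
Proof.
move=> oO sA sb sc tw.
have tA i j : test_function Omega (fun x => A i j x * pderiv i (pderiv j w) x).
  by apply: testMl => //; do 2 apply: test_pderiv => //.
have tb i : test_function Omega (fun x => b i x * pderiv i w x).
  by apply: testMl => //; apply: test_pderiv.
have tc : test_function Omega (fun x => c x * w x) by exact: testMl.
have tA' i j : test_function Omega (fun x => pderiv j (pderiv i (A i j)) x * w x).
  by apply: testMl => //; do 2 apply: smooth_pderiv.
have sb' i := smoothN oO (smooth_pderiv i (sb i)).
have tb' i : test_function Omega (fun x => - pderiv i (b i) x * w x).
  exact: testMl.
have tSA := test_sum oO (fun i => test_sum oO (tA i)).
have tSA' := test_sum oO (fun i => test_sum oO (tA' i)).
have tSb := test_sum oO tb; have tSb' := test_sum oO tb'.
rewrite (test_integralD oO (testD oO tSA tSb) tc) (test_integralD oO tSA tSb).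
rewrite (test_integral_sum oO (fun i => test_sum oO (tA i))) (test_integral_sum oO tb).
rewrite [RHS](_ : _ = \int[leb]_(x in Omega)
   (\sum_i \sum_j pderiv j (pderiv i (A i j)) x * w x +
    \sum_i - pderiv i (b i) x * w x + c x * w x)); last first.
  apply: eq_Rintegral => x _; rewrite !mulrDl; congr (_ + _ + _).
    by rewrite mulr_suml; apply: eq_bigr => i _; rewrite mulr_suml.
  by rewrite -sumrN mulr_suml.
rewrite (test_integralD oO (testD oO tSA' tSb') tc) (test_integralD oO tSA' tSb').
rewrite (test_integral_sum oO (fun i => test_sum oO (tA' i))) (test_integral_sum oO tb').
congr (_ + _ + _); apply: eq_bigr => i _; last exact: test_by_parts.
rewrite (test_integral_sum oO (tA i)) (test_integral_sum oO (tA' i)).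
by apply: eq_bigr => j _; exact: test_by_parts2.
Qed.

End integration_by_parts.

(** * The normal field and the two defects *)

Section normal_field.
Context {R : realType} {n : nat}.
Local Notation E := 'rV[R]_n.
Implicit Types (u : E -> R) (Omega : set E) (i j k : 'I_n).

(** [inv_grad] is 1/|grad u| and [bend] is (nabla n) n for the unit normal n; in
    coordinates they are the ingredients of every formula below. *)
Definition grad2 u (x : E) : R := \sum_i pderiv i u x * pderiv i u x.
Definition inv_grad u (x : E) : R := (Num.sqrt (grad2 u x))^-1.
Definition normal_coord u i (x : E) : R := unit_normal u x 0 i.
Definition bend u i (x : E) : R :=
  mxvmul (nabla (unit_normal u) x) (unit_normal u x) 0 i.

Lemma grad2E u x : grad2 u x = dotv (grad u x) (grad u x).
Proof. by rewrite /grad2 /dotv; apply: eq_bigr => i _; rewrite !mxE. Qed.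

Lemma normal_coordE u i x : normal_coord u i x = inv_grad u x * pderiv i u x.
Proof. by rewrite /normal_coord /unit_normal !mxE /inv_grad grad2E. Qed.

Lemma bendE u i x :
  bend u i x = \sum_j pderiv j (normal_coord u i) x * normal_coord u j x.
Proof.
rewrite /bend /mxvmul mxE mxE; apply: eq_bigr => j _.
by rewrite [X in X * _]mxE [X in _ * X]mxE.
Qed.

Lemma grad2_ge0 u x : 0 <= grad2 u x.
Proof. by apply: sumr_ge0 => i _; rewrite -expr2 sqr_ge0. Qed.

Lemma inv_grad2 u x : inv_grad u x * inv_grad u x = (grad2 u x)^-1.
Proof.
by rewrite /inv_grad -invfM -expr2 sqr_sqrtr// grad2_ge0.
Qed.

Lemma grad2_eq0 u x : (grad2 u x == 0) = (grad u x == 0).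
Proof.
apply/eqP/eqP => [g0|g0].
  apply/rowP => i; rewrite !mxE.
  have /eqP := g0; rewrite psumr_eq0 => [/allP H|k _]; last by rewrite -expr2 sqr_ge0.
  by have := H i (mem_index_enum _); rewrite /= -expr2 sqrf_eq0 => /eqP.
rewrite /grad2 big1// => i _; have /rowP/(_ i) := g0.
by rewrite !mxE => ->; rewrite mul0r.
Qed.

Lemma grad2_gt0 u x : grad u x != 0 -> 0 < grad2 u x.
Proof. by move=> g0; rewrite lt_neqAle grad2_ge0 andbT eq_sym grad2_eq0. Qed.

Section on_domain.
Variables (Omega : set E) (u : E -> R).
Hypothesis oO : open Omega.
Hypothesis su : smooth_on Omega u.
Hypothesis gu : forall x, Omega x -> grad u x != 0.

Let sd1 i : smooth_on Omega (pderiv i u) := smooth_pderiv i su.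
Let sd2 i j : smooth_on Omega (pderiv i (pderiv j u)) := smooth_pderiv i (sd1 j).

Lemma smooth_grad2 : smooth_on Omega (grad2 u).
Proof. by apply: smooth_sum => // i; exact: smoothM. Qed.

Lemma smooth_inv_grad : smooth_on Omega (inv_grad u).
Proof.
apply: smoothV => //.
  by apply: smooth_sqrt => //; [exact: smooth_grad2|move=> x /gu/grad2_gt0].
by move=> x /gu/grad2_gt0 g0; rewrite lt0r_neq0// sqrtr_gt0.
Qed.

Lemma smooth_normal i : smooth_on Omega (normal_coord u i).
Proof.
have -> : normal_coord u i = (fun x => inv_grad u x * pderiv i u x).
  by apply/funext => x; exact: normal_coordE.
by apply: smoothM => //; exact: smooth_inv_grad.
Qed.

Lemma smooth_bend i : smooth_on Omega (bend u i).
Proof.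
have -> : bend u i = (fun x => \sum_j pderiv j (normal_coord u i) x * normal_coord u j x).
  by apply/funext => x; exact: bendE.
apply: smooth_sum => // j; apply: smoothM => //; last exact: smooth_normal.
by apply: smooth_pderiv; exact: smooth_normal.
Qed.

Lemma pderiv_grad2 j x : Omega x ->
  pderiv j (grad2 u) x = 2 * \sum_k pderiv k u x * pderiv j (pderiv k u) x.
Proof.
move=> Ox; rewrite /grad2 pderiv_sum.
  rewrite mulr_sumr; apply: eq_bigr => k _; rewrite pderivM; first by ring.
  - exact: (smooth_differentiable (sd1 k) Ox).
  - exact: (smooth_differentiable (sd1 k) Ox).
move=> k; apply: differentiableMf; exact: (smooth_differentiable (sd1 k) Ox).
Qed.

(** Obtained by differentiating the identity |grad u|^-2 |grad u|^2 = 1, which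
    avoids the derivative of the square root. *)
Lemma pderiv_inv_grad j x : Omega x ->
  pderiv j (inv_grad u) x = - (inv_grad u x * (grad2 u x)^-1 *
    \sum_k pderiv k u x * pderiv j (pderiv k u) x).
Proof.
move=> Ox; have q0 : grad2 u x != 0 by rewrite lt0r_neq0// grad2_gt0// gu.
have dr := smooth_differentiable smooth_inv_grad Ox.
have dq := smooth_differentiable smooth_grad2 Ox.
have : pderiv j (fun y => inv_grad u y * inv_grad u y * grad2 u y) x = 0.
  rewrite (pderiv_eq_on j oO (g := fun=> 1)) ?inE// ?pderiv_cst// => y.
  by rewrite inE => /gu/grad2_gt0 y0; rewrite inv_grad2 mulVf// lt0r_neq0.
rewrite pderivM//; last exact: differentiableMf.
rewrite pderivM// pderiv_grad2// inv_grad2.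
set s := \sum_k _; set d := pderiv j (inv_grad u) x.
have r0 : inv_grad u x != 0.
  by rewrite /inv_grad invr_eq0 lt0r_neq0// sqrtr_gt0 grad2_gt0// gu.
move=> H; apply: (mulfI (mulf_neq0 q0 r0)); move: H; set q := grad2 u x in q0 *.
set r := inv_grad u x in r0 *.
have : r * r = q^-1 by exact: inv_grad2.
move=> rr H.
have -> : q * r * - (r * q^-1 * s) = - (r * r * (q * q^-1) * s) by ring.
rewrite rr divff//.
have : q * r * d = 2^-1 * (q * (r * d + r * d)) by field.
have : q * (r * d + r * d) = - (q^-1 * (2 * s)).
  by apply/eqP; rewrite -addr_eq0 addrC H.
by move=> -> ->; field.
Qed.

Lemma pderiv_normal i j x : Omega x ->
  pderiv j (normal_coord u i) x = inv_grad u x * pderiv j (pderiv i u) x -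
    inv_grad u x * (grad2 u x)^-1 * pderiv i u x *
    \sum_k pderiv k u x * pderiv j (pderiv k u) x.
Proof.
move=> Ox.
have -> : normal_coord u i = (fun x => inv_grad u x * pderiv i u x).
  by apply/funext => y; exact: normal_coordE.
rewrite pderivM; last 2 first.
- exact: (smooth_differentiable smooth_inv_grad Ox).
- exact: (smooth_differentiable (sd1 i) Ox).
by rewrite pderiv_inv_grad//; ring.
Qed.

(** (nabla n) n is the projection of Hess u n / |grad u| orthogonally to n. The
    symmetry of the Hessian is used here to exchange the two indices. *)
Lemma bend_hessE i x : Omega x ->
  bend u i x = (grad2 u x)^-1 * \sum_j pderiv i (pderiv j u) x * pderiv j u x -
    (grad2 u x)^-1 * (grad2 u x)^-1 * pderiv i u x *
    \sum_j \sum_k pderiv j (pderiv k u) x * pderiv j u x * pderiv k u x.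
Proof.
move=> Ox; rewrite bendE !mulr_sumr -sumrB; apply: eq_bigr => j _.
rewrite pderiv_normal// normal_coordE (pderivC j i oO su Ox).
set r := inv_grad u x; set h := pderiv i (pderiv j u) x.
have rr : r * r = (grad2 u x)^-1 by exact: inv_grad2.
set T := \sum_k _; set T' := \sum_k _.
have -> : T' = pderiv j u x * T.
  by rewrite mulr_sumr; apply: eq_bigr => k _; ring.
by rewrite -rr; ring.
Qed.

End on_domain.

End normal_field.

Section defects.
Context {R : realType} {n : nat}.
Local Notation E := 'rV[R]_n.

Definition hess_grad2 (u : E -> R) (x : E) : R :=
  \sum_i \sum_j pderiv i (pderiv j u) x * pderiv i u x * pderiv j u x.

Lemma frob_normal_proj (u : E -> R) x (A : 'M[R]_n) :
  frob (normal_proj u x) A = \sum_i \sum_j normal_coord u i x * normal_coord u j x * A i j.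
Proof.
by rewrite /frob; apply: eq_bigr => i _; apply: eq_bigr => j _; rewrite /normal_proj mxE.
Qed.

(** The square roots in the normal cancel: the defect is a rational function of
    the derivatives of u, hence easy to expand along u + s w. *)
Lemma profile_defectE eps (u : E -> R) x : profile_defect eps u x =
  eps * (hess_grad2 u x * (grad2 u x)^-1) - derive1 double_well (u x) / eps.
Proof.
congr (eps * _ - _); rewrite /frob /hess_grad2 mulr_suml.
apply: eq_bigr => i _; rewrite mulr_suml; apply: eq_bigr => j _.
have -> : normal_proj u x i j = normal_coord u i x * normal_coord u j x.
  by rewrite /normal_proj mxE.
have -> : hess u x i j = pderiv i (pderiv j u) x by rewrite mxE.
rewrite !normal_coordE.
by rewrite -inv_grad2; ring.
Qed.

Variables (Omega : set E) (u : E -> R).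
Hypothesis oO : open Omega.
Hypothesis su : smooth_on Omega u.

Lemma smooth_dW : smooth_on Omega (fun x => derive1 double_well (u x)).
Proof.
rewrite derive1_double_well.
have s2 : smooth_on Omega (fun x => u x * u x) by exact: smoothM.
have s3 : smooth_on Omega (fun x => u x * (u x * u x)) by exact: smoothM.
have sc (a : R) : smooth_on Omega (fun=> a) by exact: smooth_cst.
apply: smoothD => //; last exact: smoothM.
apply: smoothD => //.
apply: (@smooth_eq_on _ _ _ (fun x => (-3) * (u x * u x))) => //.
  by move=> x _; rewrite mulNr.
exact: smoothM.
Qed.

Lemma smooth_d2W : smooth_on Omega (fun x => derive1n 2 double_well (u x)).
Proof.
rewrite derive2_double_well.
have s2 : smooth_on Omega (fun x => u x * u x) by exact: smoothM.
have sc (a : R) : smooth_on Omega (fun=> a) by exact: smooth_cst.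
apply: smoothD => //; last exact: smoothM.
apply: smoothD => //.
apply: (@smooth_eq_on _ _ _ (fun x => (-6) * u x)) => //.
  by move=> x _; rewrite mulNr.
exact: smoothM.
Qed.

Lemma smooth_laplacian (v : E -> R) : smooth_on Omega v -> smooth_on Omega (laplacian v).
Proof.
by move=> sv; apply: smooth_sum => // i; do 2 apply: smooth_pderiv.
Qed.

Lemma smooth_combination (a b : R) (f g : E -> R) : smooth_on Omega f -> smooth_on Omega g ->
  smooth_on Omega (fun x => a * f x - g x / b).
Proof.
move=> sf sg.
apply: (@smooth_eq_on _ _ _ (fun x => a * f x + (- b^-1) * g x)) => //.
  by move=> x _; rewrite mulNr mulrC [g x / b]mulrC mulrC.
by apply: smoothD => //; apply: smoothM => //; exact: smooth_cst.
Qed.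

Lemma smooth_willmore_defect eps : smooth_on Omega (willmore_defect eps u).
Proof.
by apply: smooth_combination; [exact: smooth_laplacian|exact: smooth_dW].
Qed.

Lemma smooth_profile_defect eps : (forall x, Omega x -> grad u x != 0) ->
  smooth_on Omega (profile_defect eps u).
Proof.
move=> gu; have -> : profile_defect eps u = (fun x =>
    eps * (hess_grad2 u x * (grad2 u x)^-1) - derive1 double_well (u x) / eps).
  by apply/funext => x; exact: profile_defectE.
apply: smooth_combination; last exact: smooth_dW.
apply: smoothM => //; last first.
  apply: smoothV => //; first exact: smooth_grad2.
  by move=> x /gu/grad2_gt0/lt0r_neq0.
apply: smooth_sum => // i; apply: smooth_sum => // j.
by apply: smoothM => //; [apply: smoothM => //|]; repeat apply: smooth_pderiv.
Qed.

End defects.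

(** * First variation of the two defects *)

Section perturbation.
Context {R : realType} {n : nat}.
Local Notation E := 'rV[R]_n.
Local Notation leb := (lebesgue_row n).
Variables (Omega : set E) (u w : E -> R) (eps : R).
Hypothesis oO : open Omega.
Hypothesis su : smooth_on Omega u.
Hypothesis tw : test_function Omega w.
Local Notation K := (closure [set x | w x != 0]).
Local Notation pert s := (fun x : E => u x + s * w x).

Let sw : smooth_on Omega w := test_smooth tw.

Lemma smooth_pert s : smooth_on Omega (pert s).
Proof. by apply: smoothD => //; apply: smoothM => //; exact: smooth_cst. Qed.

Lemma pert0 : pert 0 = u.
Proof. by apply/funext => x; rewrite mul0r addr0. Qed.

Lemma pderiv_pert_on (f g : E -> R) s i x : smooth_on Omega f -> smooth_on Omega g ->
  Omega x -> pderiv i (fun y => f y + s * g y) x = pderiv i f x + s * pderiv i g x.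
Proof.
move=> sf sg Ox; have dg := smooth_differentiable sg Ox.
rewrite pderivD.
- by rewrite pderivZ.
- exact: (smooth_differentiable sf Ox).
- by apply: differentiableMf => //; exact: differentiable_cst.
Qed.

Lemma pderiv2_pert s i j x : Omega x -> pderiv i (pderiv j (pert s)) x =
  pderiv i (pderiv j u) x + s * pderiv i (pderiv j w) x.
Proof.
move=> Ox; rewrite -(pderiv_pert_on s i (smooth_pderiv j su) (smooth_pderiv j sw) Ox).
apply: (pderiv_eq_on i oO); last by rewrite inE.
by move=> y; rewrite inE => Oy; exact: pderiv_pert_on.
Qed.

Lemma bounded_on_support (f : E -> R) : smooth_on Omega f ->
  exists M, forall x, K x -> `|f x| <= M.
Proof.
move=> sf; have [M _ HM] := continuous_bounded_on (test_support_compact tw)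
  (fun x Kx => smooth_continuous sf (test_support_sub tw Kx)).
by exists M.
Qed.

Lemma expands_smooth (f g : E -> R) : smooth_on Omega f -> smooth_on Omega g ->
  expands K (fun s x => f x + s * g x) f g.
Proof. by move=> sf sg; apply: expands_affine; exact: bounded_on_support. Qed.

Lemma expandsZ (c : R) F a b : expands K F a b ->
  expands K (fun s x => c * F s x) (fun x => c * a x) (fun x => c * b x).
Proof.
move=> HF; have sc (d : R) : smooth_on Omega (fun=> d) by exact: smooth_cst.
apply: expands_eq (expandsM (expands_smooth (sc c) (sc 0)) HF) => [s|x|x] *; ring.
Qed.

Lemma expands_dW : expands K (fun s x => derive1 double_well (u x + s * w x))
  (fun x => derive1 double_well (u x)) (fun x => derive1n 2 double_well (u x) * w x).
Proof.
have V := expands_smooth su sw.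
have V2 := expandsM V V; have V3 := expandsM V V2.
have := expandsD (expandsD V (expandsZ (-3) V2)) (expandsZ 2 V3).
apply: expands_eq => [s|x|x] *; rewrite ?derive1_double_well ?derive2_double_well; ring.
Qed.

Lemma support_sub x : K x -> Omega x.
Proof. exact: (test_support_sub tw). Qed.

Lemma expands_laplacian : expands K (fun s => laplacian (pert s)) (laplacian u) (laplacian w).
Proof.
have H i : expands K (fun s x => pderiv i (pderiv i u) x + s * pderiv i (pderiv i w) x)
    (pderiv i (pderiv i u)) (pderiv i (pderiv i w)).
  by apply: expands_smooth; do 2 apply: smooth_pderiv.
apply: expands_eq (expands_sum H) => // s x Kx.
by rewrite /laplacian; apply: eq_bigr => i _; rewrite pderiv2_pert//; exact: support_sub.
Qed.

Definition willmore_variation x : R :=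
  eps * laplacian w x - eps^-1 * (derive1n 2 double_well (u x) * w x).

Lemma expands_willmore : expands K (fun s => willmore_defect eps (pert s))
  (willmore_defect eps u) willmore_variation.
Proof.
have := expandsD (expandsZ eps expands_laplacian) (expandsZ (- eps^-1) expands_dW).
apply: expands_eq => [s|x|x] *; rewrite /willmore_defect /willmore_variation; ring.
Qed.

Lemma expands_grad2 : expands K (fun s => grad2 (pert s)) (grad2 u)
  (fun x => 2 * \sum_i pderiv i u x * pderiv i w x).
Proof.
have H i : expands K (fun s x => pderiv i u x + s * pderiv i w x) (pderiv i u) (pderiv i w).
  by apply: expands_smooth; exact: smooth_pderiv.
apply: expands_eq (expands_sum (fun i => expandsM (H i) (H i))) => [s x|x|x] Kx //.
  by rewrite /grad2; apply: eq_bigr => i _; rewrite pderiv_pert_on//; exact: support_sub.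
by rewrite mulr_sumr; apply: eq_bigr => i _; ring.
Qed.

Definition hess_bilin (f : E -> R) (g h : E -> R) (x : E) : R :=
  \sum_i \sum_j pderiv i (pderiv j f) x * pderiv i g x * pderiv j h x.

Lemma expands_hess_grad2 : expands K (fun s => hess_grad2 (pert s)) (hess_grad2 u)
  (fun x => hess_bilin w u u x + 2 * hess_bilin u w u x).
Proof.
have H i : expands K (fun s x => pderiv i u x + s * pderiv i w x) (pderiv i u) (pderiv i w).
  by apply: expands_smooth; exact: smooth_pderiv.
have H2 i j : expands K (fun s x => pderiv i (pderiv j u) x + s * pderiv i (pderiv j w) x)
    (pderiv i (pderiv j u)) (pderiv i (pderiv j w)).
  by apply: expands_smooth; do 2 apply: smooth_pderiv.
have T := expands_sum (fun i => expands_sum (fun j => expandsM (expandsM (H2 i j) (H i)) (H j))).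
apply: expands_eq T => [s x|x|x] Kx //; have Ox := support_sub Kx.
  rewrite /hess_grad2; apply: eq_bigr => i _; apply: eq_bigr => j _.
  by rewrite pderiv2_pert// !pderiv_pert_on.
have -> : 2 * hess_bilin u w u x = hess_bilin u w u x + hess_bilin u u w x.
  rewrite mulr_natl mulr2n; congr (_ + _); rewrite /hess_bilin exchange_big/=.
  apply: eq_bigr => i _; apply: eq_bigr => j _.
  rewrite (pderivC j i oO su Ox).
  by move: (pderiv i _ x) (pderiv j u x) (pderiv i w x) => a b c; ring.
rewrite /hess_bilin -!big_split/=; apply: eq_bigr => i _.
rewrite -!big_split/=; apply: eq_bigr => j _.
move: (pderiv i (pderiv j u) x) (pderiv i (pderiv j w) x).
move: (pderiv i u x) (pderiv i w x) (pderiv j u x) (pderiv j w x).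
by move=> a b c d f g; ring.
Qed.

Hypothesis gu : forall x, Omega x -> grad u x != 0.

Definition profile_variation x : R :=
  eps * (\sum_i \sum_j normal_coord u i x * normal_coord u j x * pderiv i (pderiv j w) x
         + \sum_i 2 * bend u i x * pderiv i w x)
  - eps^-1 * (derive1n 2 double_well (u x) * w x).

(** Differentiating the quotient Hess u (grad u, grad u) / |grad u|^2 in the
    direction w yields N : Hess w and a first-order term in w, which
    [bend_hessE] identifies as 2 (nabla n) n . grad w. *)
Lemma expands_profile : expands K (fun s => profile_defect eps (pert s))
  (profile_defect eps u) profile_variation.
Proof.
have g0 x : K x -> grad2 u x != 0.
  by move=> /support_sub/gu/grad2_gt0/lt0r_neq0.
have V : expands K (fun s x => (grad2 (pert s) x)^-1) (fun x => (grad2 u x)^-1)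
    (fun x => - (2 * \sum_i pderiv i u x * pderiv i w x) * ((grad2 u x)^-1 * (grad2 u x)^-1)).
  apply: expandsV => //; last exact: expands_grad2.
  apply: bounded_on_support; apply: smoothV => //; first exact: smooth_grad2.
  by move=> x /gu/grad2_gt0/lt0r_neq0.
have := expandsD (expandsZ eps (expandsM expands_hess_grad2 V)) (expandsZ (- eps^-1) expands_dW).
apply: expands_eq => [s x|x|x] Kx; rewrite ?profile_defectE; [ring|ring|].
have Ox := support_sub Kx; rewrite /profile_variation.
have A : \sum_i \sum_j normal_coord u i x * normal_coord u j x * pderiv i (pderiv j w) x =
    (grad2 u x)^-1 * hess_bilin w u u x.
  rewrite /hess_bilin mulr_sumr; apply: eq_bigr => i _; rewrite mulr_sumr.
  apply: eq_bigr => j _; rewrite !normal_coordE -inv_grad2.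
  move: (pderiv i (pderiv j w) x) (inv_grad u x) (pderiv i u x) (pderiv j u x).
  by move=> a b c d; ring.
have B : \sum_i 2 * bend u i x * pderiv i w x =
    2 * ((grad2 u x)^-1 * hess_bilin u w u x
    - (grad2 u x)^-1 * (grad2 u x)^-1 * hess_grad2 u x * \sum_i pderiv i u x * pderiv i w x).
  rewrite /hess_bilin [X in 2 * (X - _)]mulr_sumr [X in 2 * (_ - X)]mulr_sumr -sumrB mulr_sumr.
  apply: eq_bigr => i _.
  rewrite (bend_hessE oO su gu i Ox) -/(hess_grad2 u x).
  rewrite (_ : \sum_j pderiv i (pderiv j u) x * pderiv i w x * pderiv j u x =
    pderiv i w x * \sum_j pderiv i (pderiv j u) x * pderiv j u x).
    move: (\sum_j _) (hess_grad2 u x) (grad2 u x)^-1 (pderiv i u x) (pderiv i w x).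
    by move=> S P q a b; ring.
  rewrite mulr_sumr; apply: eq_bigr => j _.
  move: (pderiv i (pderiv j u) x) (pderiv i w x) (pderiv j u x) => a b c; ring.
rewrite A B; ring.
Qed.

(** On the support of w, |grad (u + s w)|^2 differs from |grad u|^2 by at most
    2 C |s|, and 1 / |grad u|^2 is bounded there by M; a zero would therefore
    force 1 <= 2 C M |s|. Off the support the gradient is that of u. *)
Lemma pert_grad_neq0 : exists2 d, 0 < d & forall s x, `|s| <= d -> Omega x ->
  grad (pert s) x != 0.
Proof.
have [C C1 H] := expands_grad2.
have [M HM] : exists M, forall x, K x -> `|(grad2 u x)^-1| <= M.
  apply: bounded_on_support; apply: smoothV => //; first exact: smooth_grad2.
  by move=> x /gu/grad2_gt0/lt0r_neq0.
have M0 := normr_ge0 M.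
have P : 0 < 3 * C * (`|M| + 1) by rewrite mulr_gt0; lra.
have PC : C <= 3 * C * (`|M| + 1).
  rewrite -mulrA mulrCA ler_peMr//; lra.
exists (3 * C * (`|M| + 1))^-1 => [|s x sd Ox]; first by rewrite invr_gt0.
have [Kx|nKx] := pselect (K x); last first.
  suff -> : grad (pert s) x = grad u x by exact: gu.
  apply/rowP => i; rewrite !mxE pderiv_pert_on//.
  have -> : pderiv i w x = 0.
    by apply: vanishing_pderiv0 nKx; [exact: closed_closure|exact: out_support0].
  by rewrite mulr0 addr0.
rewrite -grad2_eq0; apply/negP => /eqP g0.
have sC : `|s| <= C^-1 by apply: (le_trans sd); rewrite lef_pV2// posrE; lra.
have [_ bC rC] := H s x sC Kx; rewrite g0 sub0r in rC.
have s1 : `|s| <= 1 := le_trans sC (inv_le1 C1).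
have ux := gu Ox; have q0 := grad2_gt0 ux.
set b := 2 * \sum_i _ in bC rC; set q := grad2 u x in q0 rC.
have qb : `|q| <= 2 * C * `|s|.
  have -> : q = - (- q - s * b) - s * b by ring.
  apply: (le_trans (ler_normB _ _)); rewrite normrN.
  have : `|s * b| <= `|s| * C by rewrite normrM ler_pM.
  have : C * s ^+ 2 <= C * `|s|.
    by rewrite ler_pM2l; [rewrite -real_normK ?num_real// expr2 ler_piMl|lra].
  lra.
have qM : `|q| * `|q^-1| <= 2 * C * `|s| * `|M|.
  by apply: ler_pM => //; apply: (le_trans (HM x Kx)); exact: ler_norm.
rewrite -normrM divff ?normr1 ?lt0r_neq0// in qM.
have : `|s| * (3 * C * (`|M| + 1)) <= 1 by rewrite -ler_pdivlMr// div1r.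
have -> : `|s| * (3 * C * (`|M| + 1)) = 3 * (C * `|s| * `|M|) + 3 * (C * `|s|) by ring.
have E2 : 2 * C * `|s| * `|M| = 2 * (C * `|s| * `|M|) by ring.
rewrite E2 in qM.
have : 0 <= C * `|s| by rewrite mulr_ge0//; lra.
lra.
Qed.

End perturbation.

Section locality.
Context {R : realType} {n : nat}.
Local Notation E := 'rV[R]_n.

Lemma willmore_defect_eq_on (O : set E) eps (f g : E -> R) : open O ->
  {in O, f =1 g} -> {in O, willmore_defect eps f =1 willmore_defect eps g}.
Proof.
move=> oO fg x Ox.
have L : laplacian f x = laplacian g x.
  rewrite /laplacian; apply: eq_bigr => i _.
  exact: (pderiv_eq_on i oO (pderiv_eq_on i oO fg) Ox).
by rewrite /willmore_defect L (fg x Ox).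
Qed.

Lemma profile_defect_eq_on (O : set E) eps (f g : E -> R) : open O ->
  {in O, f =1 g} -> {in O, profile_defect eps f =1 profile_defect eps g}.
Proof.
move=> oO fg x Ox.
have d1 i : pderiv i f x = pderiv i g x by exact: (pderiv_eq_on i oO fg Ox).
have d2 i j : pderiv i (pderiv j f) x = pderiv i (pderiv j g) x.
  exact: (pderiv_eq_on i oO (pderiv_eq_on j oO fg) Ox).
have H : hess_grad2 f x = hess_grad2 g x.
  rewrite /hess_grad2; apply: eq_bigr => i _; apply: eq_bigr => j _.
  by rewrite (d2 i j) (d1 i) (d1 j).
have G : grad2 f x = grad2 g x by rewrite /grad2; apply: eq_bigr => i _; rewrite (d1 i).
by rewrite !profile_defectE H G (fg x Ox).
Qed.

Lemma pert_off_support (w u : E -> R) s :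
  {in ~` closure [set x | w x != 0], (fun y => u y + s * w y) =1 u}.
Proof. by move=> x; rewrite inE => nx; rewrite (out_support0 nx) mulr0 addr0. Qed.

End locality.

Section first_variation.
Context {R : realType} {n : nat}.
Local Notation E := 'rV[R]_n.
Local Notation leb := (lebesgue_row n).
Variables (Omega : set E) (u w : E -> R) (eps : R).
Hypothesis oO : open Omega.
Hypothesis bO : bounded_set Omega.
Hypothesis su : smooth_on Omega u.
Hypothesis gu : forall x, Omega x -> grad u x != 0.
Hypothesis tw : test_function Omega w.
Hypothesis fin : finite_err_energy Omega eps u.
Local Notation pert s := (fun x : E => u x + s * w x).
Local Notation K := (closure [set x | w x != 0]).

Let mO := row_open_measurable oO.
Let sw := test_smooth tw.

Let oKc : open (~` K).
Proof. by apply: closed_openC; exact: closed_closure. Qed.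

Lemma test_laplacian : test_function Omega (laplacian w).
Proof. by apply: test_sum => // i; do 2 apply: test_pderiv => //. Qed.

Lemma test_willmore_variation : test_function Omega (willmore_variation u w eps).
Proof.
have -> : willmore_variation u w eps = (fun x => eps * laplacian w x +
    (- eps^-1 * derive1n 2 double_well (u x)) * w x).
  by apply/funext => x; rewrite /willmore_variation; ring.
apply: testD => //; first by apply: testMl => //; [exact: smooth_cst|exact: test_laplacian].
by apply: testMl => //; apply: smoothM => //; [exact: smooth_cst|exact: smooth_d2W].
Qed.

Lemma test_profile_variation : test_function Omega (profile_variation u w eps).
Proof.
have -> : profile_variation u w eps = (fun x => eps *
   (\sum_i \sum_j normal_coord u i x * normal_coord u j x * pderiv i (pderiv j w) x
         + \sum_i 2 * bend u i x * pderiv i w x) +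
    (- eps^-1 * derive1n 2 double_well (u x)) * w x).
  by apply/funext => x; rewrite /profile_variation; ring.
have sc (a : R) : smooth_on Omega (fun=> a) by exact: smooth_cst.
apply: testD => //; last first.
  by apply: testMl => //; apply: smoothM => //; exact: smooth_d2W.
apply: testMl => //; apply: testD => //.
  apply: test_sum => // i; apply: test_sum => // j; apply: testMl => //.
    by apply: smoothM => //; exact: smooth_normal.
  by do 2 apply: test_pderiv => //.
apply: test_sum => // i; apply: testMl => //; last exact: test_pderiv.
by apply: smoothM => //; exact: smooth_bend.
Qed.

Lemma variation_cvg (D : (E -> R) -> E -> R) (D1 : E -> R) :
  smooth_on Omega (D u) ->
  expands K (fun s => D (pert s)) (D u) D1 ->
  test_function Omega D1 -> (forall x, ~ K x -> D1 x = 0) ->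
  (forall s, {in ~` K, D (pert s) =1 D u}) ->
  (exists2 d, 0 < d & forall s, `|s| <= d -> smooth_on Omega (D (pert s))) ->
  leb.-integrable Omega (EFin \o (fun x => D u x ^+ 2)) ->
  (\int[leb]_(x in Omega) (D (pert s) x ^+ 2) - \int[leb]_(x in Omega) (D u x ^+ 2)) / s
    @[s --> 0^'] --> \int[leb]_(x in Omega) (2 * D u x * D1 x).
Proof.
move=> sD expD tD1 D1K DK [d d0 sd] iD.
have := @integral_sq_variation _ _ Omega K (fun s => D (pert s)) D1 oO bO.
rewrite (_ : D (pert 0) = D u); last by rewrite pert0.
apply => //.
- by move=> s x _ nKx; apply: DK; rewrite inE.
- by move=> x _ nKx; exact: D1K.
- exists d => // s x sx Ox; exact: (smooth_continuous (sd s sx) Ox).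
- by move=> x Ox; exact: (test_continuous tD1).
- apply: (test_integrable mO (Omega := Omega)).
  by apply: testMl => //; apply: smoothM => //; exact: smooth_cst.
Qed.

Let vanish i x : ~ K x -> pderiv i w x = 0.
Proof. by apply: vanishing_pderiv0; [exact: closed_closure|exact: out_support0]. Qed.

Let vanish2 i j x : ~ K x -> pderiv i (pderiv j w) x = 0.
Proof. by apply: vanishing_pderiv0; [exact: closed_closure|exact: vanish]. Qed.

Lemma willmore_cvg :
  (\int[leb]_(x in Omega) (willmore_defect eps (pert s) x ^+ 2) -
   \int[leb]_(x in Omega) (willmore_defect eps u x ^+ 2)) / s
    @[s --> 0^'] -->
  \int[leb]_(x in Omega) (2 * willmore_defect eps u x * willmore_variation u w eps x).
Proof.
apply: variation_cvg.
- exact: smooth_willmore_defect.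
- exact: (expands_willmore eps oO su tw).
- exact: test_willmore_variation.
- move=> x nKx; rewrite /willmore_variation (out_support0 nKx) /laplacian big1 ?mulr0 ?subr0//.
  by move=> i _; exact: vanish2.
- by move=> s; apply: willmore_defect_eq_on => //; exact: pert_off_support.
- exists 1 => // s _; apply: smooth_willmore_defect => //; exact: smooth_pert.
- by case: fin.
Qed.

Lemma profile_cvg :
  (\int[leb]_(x in Omega) (profile_defect eps (pert s) x ^+ 2) -
   \int[leb]_(x in Omega) (profile_defect eps u x ^+ 2)) / s
    @[s --> 0^'] -->
  \int[leb]_(x in Omega) (2 * profile_defect eps u x * profile_variation u w eps x).
Proof.
apply: variation_cvg.
- exact: smooth_profile_defect.
- exact: (expands_profile eps oO su tw gu).
- exact: test_profile_variation.
- move=> x nKx; rewrite /profile_variation (out_support0 nKx) !mulr0 subr0.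
  rewrite !big1 ?addr0 ?mulr0// => i _; first by rewrite (vanish i nKx) mulr0.
  by rewrite big1// => j _; rewrite (vanish2 i j nKx) mulr0.
- by move=> s; apply: profile_defect_eq_on => //; exact: pert_off_support.
- have [d d0 H] := pert_grad_neq0 oO su tw gu; exists d => // s sd.
  apply: smooth_profile_defect => //; first exact: smooth_pert.
  by move=> x; exact: H.
- by case: fin.
Qed.

End first_variation.

(** * The adjoint of the linearized profile operator *)

Section adjoint.
Context {R : realType} {n : nat}.
Local Notation E := 'rV[R]_n.
Local Notation leb := (lebesgue_row n).
Variable Omega : set E.
Hypothesis oO : open Omega.

(** For any smooth vector field N, with c = (nabla N) N, the inner divergence of
    f N (x) N is (N . grad f) N + f (div N) N + f c. Its divergence contains
    c . grad f twice and f div c once; subtracting twice the divergence of f c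
    leaves no first-order term in c and the sign minus in front of div c. *)
Lemma adjoint_identity (N : 'I_n -> E -> R) (f : E -> R) x :
  (forall i, smooth_on Omega (N i)) -> smooth_on Omega f -> Omega x ->
  let dv y := \sum_i pderiv i (N i) y in
  let c j y := \sum_i pderiv i (N j) y * N i y in
  \sum_i \sum_j pderiv j (pderiv i (fun y => f y * (N i y * N j y))) x
    - \sum_i pderiv i (fun y => f y * (2 * c i y)) x =
  \sum_i \sum_j N i x * N j x * pderiv i (pderiv j f) x
    + 2 * (dv x * \sum_i N i x * pderiv i f x)
    + (\sum_i pderiv i (fun y => dv y * N i y) x - \sum_i pderiv i (c i) x) * f x.
Proof.
move=> sN sf Ox dv c.
have dN i y : Omega y -> differentiable (N i) y by exact: smooth_differentiable (sN i).
have df y : Omega y -> differentiable f y by exact: smooth_differentiable sf.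
have sdv : smooth_on Omega dv by apply: smooth_sum => // i; exact: smooth_pderiv.
have sc j : smooth_on Omega (c j).
  by apply: smooth_sum => // i; apply: smoothM => //; exact: smooth_pderiv.
pose p y := \sum_i N i y * pderiv i f y.
have sp : smooth_on Omega p.
  by apply: smooth_sum => // i; apply: smoothM => //; exact: smooth_pderiv.
have ddv : differentiable dv x := smooth_differentiable sdv Ox.
have dc j : differentiable (c j) x := smooth_differentiable (sc j) Ox.
have dp : differentiable p x := smooth_differentiable sp Ox.
have sfN i j : smooth_on Omega (fun y => f y * (N i y * N j y)).
  by apply: smoothM => //; exact: smoothM.
(* p is N . grad f and c is (nabla N) N *)
have inner j : {in Omega, (fun y => \sum_i pderiv i (fun z => f z * (N i z * N j z)) y)
    =1 (fun y => (p y * N j y + f y * (dv y * N j y)) + f y * c j y)}.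
  move=> y; rewrite inE => Oy.
  rewrite /p /dv /c !(mulr_suml, mulr_sumr) -!big_split/=; apply: eq_bigr => i _.
  rewrite (pderivM i (df y Oy) (differentiableMf (dN i y Oy) (dN j y Oy))).
  rewrite (pderivM i (dN i y Oy) (dN j y Oy)).
  move: (f y) (N i y) (N j y) (pderiv i f y) (pderiv i (N i) y) (pderiv i (N j) y).
  by move=> ? ? ? ? ? ?; ring.
have outer j : \sum_i pderiv j (pderiv i (fun y => f y * (N i y * N j y))) x =
    p x * pderiv j (N j) x + N j x * pderiv j p x
    + f x * pderiv j (fun y => dv y * N j y) x + dv x * N j x * pderiv j f x
    + f x * pderiv j (c j) x + c j x * pderiv j f x.
  rewrite -(pderiv_sum (F := fun i => pderiv i (fun y => f y * (N i y * N j y)))); last first.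
    by move=> i; exact: (smooth_differentiable (smooth_pderiv i (sfN i j)) Ox).
  rewrite (pderiv_eq_on j oO (inner j)) ?inE//.
  have d1 := differentiableMf dp (dN j x Ox).
  have d2 := differentiableMf ddv (dN j x Ox).
  have d3 := differentiableMf (df x Ox) d2.
  have d4 := differentiableMf (df x Ox) (dc j).
  rewrite (pderivD j (differentiableDf d1 d3) d4) (pderivD j d1 d3).
  rewrite (pderivM j dp (dN j x Ox)) (pderivM j (df x Ox) d2) (pderivM j (df x Ox) (dc j)).
  by rewrite !addrA.
have pj j : pderiv j p x = \sum_i (N i x * pderiv j (pderiv i f) x + pderiv i f x * pderiv j (N i) x).
  have dfi i := smooth_differentiable (smooth_pderiv i sf) Ox.
  rewrite /p pderiv_sum; last by move=> i; apply: differentiableMf => //; exact: dN.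
  by apply: eq_bigr => i _; rewrite (pderivM j (dN i x Ox) (dfi i)).
have b2 i : pderiv i (fun y => f y * (2 * c i y)) x =
    2 * (f x * pderiv i (c i) x + c i x * pderiv i f x).
  have -> : (fun y => f y * (2 * c i y)) = (fun y => 2 * (f y * c i y)).
    by apply/funext => y; rewrite mulrCA.
  by rewrite (pderivZ i 2 (differentiableMf (df x Ox) (dc i))) (pderivM i (df x Ox) (dc i)).
rewrite exchange_big/= (eq_bigr _ (fun j _ => outer j)) (eq_bigr _ (fun j _ => b2 j)).
have np : \sum_j N j x * pderiv j p x =
    \sum_i \sum_j N i x * N j x * pderiv i (pderiv j f) x + \sum_j c j x * pderiv j f x.
  transitivity (\sum_j \sum_i (N j x * N i x * pderiv j (pderiv i f) x +
      pderiv j (N i) x * N j x * pderiv i f x)).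
    apply: eq_bigr => j _; rewrite pj mulr_sumr; apply: eq_bigr => i _.
    move: (N j x) (N i x) (pderiv j (pderiv i f) x) (pderiv i f x) (pderiv j (N i) x).
    by move=> ? ? ? ? ?; ring.
  rewrite [RHS](_ : _ = \sum_j \sum_i N j x * N i x * pderiv j (pderiv i f) x +
     \sum_j \sum_i pderiv j (N i) x * N j x * pderiv i f x).
    by rewrite -big_split/=; apply: eq_bigr => j _; rewrite big_split.
  congr (_ + _); rewrite exchange_big/=; apply: eq_bigr => i _.
  by rewrite /c mulr_suml.
have e1 : \sum_j p x * pderiv j (N j) x = p x * dv x by rewrite -mulr_sumr.
have e2 : \sum_j f x * pderiv j (fun y => dv y * N j y) x =
    f x * \sum_j pderiv j (fun y => dv y * N j y) x by rewrite -mulr_sumr.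
have e3 : \sum_j dv x * N j x * pderiv j f x = dv x * p x.
  by rewrite mulr_sumr; apply: eq_bigr => i _; rewrite mulrA.
have e4 : \sum_j f x * pderiv j (c j) x = f x * \sum_j pderiv j (c j) x.
  by rewrite -mulr_sumr.
have e5 : \sum_j 2 * (f x * pderiv j (c j) x + c j x * pderiv j f x) =
    2 * (f x * \sum_j pderiv j (c j) x + \sum_j c j x * pderiv j f x).
  by rewrite -mulr_sumr big_split/= e4.
rewrite e5 !big_split/= e1 np e2 e3 e4 -/(p x).
move: (\sum_i \sum_j _) (\sum_i pderiv i (fun y => dv y * N i y) x) => H D.
move: (\sum_i pderiv i (c i) x) (\sum_j c j x * pderiv j f x) (p x) (dv x) (f x).
by move=> ? ? ? ? ?; ring.
Qed.

End adjoint.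

(** * The gradient of the energy *)

Section err_gradient.
Context {R : realType} {n : nat}.
Local Notation E := 'rV[R]_n.
Local Notation leb := (lebesgue_row n).
Implicit Types (u : E -> R) (eps alpha beta : R).

(** The quantities of the system as functions of u alone: [potential] is mu,
    [penalty] is L, [flow_speed] is the right-hand side of the evolution equation,
    and [normal_operator] gathers the terms of L in which the double well
    does not appear. *)
Definition potential eps u (x : E) : R :=
  derive1 double_well (u x) - eps ^+ 2 * laplacian u x.

Definition normal_operator u (f : E -> R) (x : E) : R :=
  frob (normal_proj u x) (hess f x)
  + 2 * dotv (divergence (unit_normal u) x *: unit_normal u x) (grad f x)
  + (divergence (fun y => divergence (unit_normal u) y *: unit_normal u y) x
     - divergence (fun y => mxvmul (nabla (unit_normal u) y) (unit_normal u y)) x) * f x.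

Definition penalty eps alpha u (x : E) : R :=
  2 * eps `^ (1 - alpha) *
    (normal_operator u (profile_defect eps u) x
     - (eps ^+ 2)^-1 * derive1n 2 double_well (u x) * profile_defect eps u x).

Definition flow_speed eps alpha beta u (x : E) : R :=
  laplacian (potential eps u) x
  - (eps ^+ 2)^-1 * derive1n 2 double_well (u x) * potential eps u x
  - beta * penalty eps alpha u x.

Definition err_gradient eps alpha beta u (x : E) : R :=
  - eps^-1 * flow_speed eps alpha beta u x.

(** The adjoint of w |-> N(u) : Hess w + 2 (nabla n) n . grad w, as integration by
    parts produces it. *)
Definition normal_adjoint u (f : E -> R) (x : E) : R :=
  \sum_i \sum_j pderiv j (pderiv i
    (fun y => f y * (normal_coord u i y * normal_coord u j y))) x
  - \sum_i pderiv i (fun y => f y * (2 * bend u i y)) x.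

Variables (Omega : set E) (u : E -> R) (eps alpha beta : R).
Hypothesis oO : open Omega.
Hypothesis su : smooth_on Omega u.
Hypothesis gu : forall x, Omega x -> grad u x != 0.
Hypothesis eps_gt0 : 0 < eps.

Let mO := row_open_measurable oO.
Let eps0 : eps != 0 := lt0r_neq0 eps_gt0.
Let sc (a : R) : smooth_on Omega (fun=> a) := smooth_cst a oO.
Let sN i : smooth_on Omega (normal_coord u i) := smooth_normal oO su gu i.
Let sB i : smooth_on Omega (bend u i) := smooth_bend oO su gu i.
Let sW2 : smooth_on Omega (fun x => derive1n 2 double_well (u x)) := smooth_d2W oO su.
Let sa : smooth_on Omega (willmore_defect eps u) := smooth_willmore_defect oO su eps.
Let sxi : smooth_on Omega (profile_defect eps u) := smooth_profile_defect oO su eps gu.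

Lemma smooth_normal_adjoint f : smooth_on Omega f -> smooth_on Omega (normal_adjoint u f).
Proof.
move=> sf.
have sA i j : smooth_on Omega (fun y => f y * (normal_coord u i y * normal_coord u j y)).
  by apply: (smoothM oO sf); exact: smoothM.
have sb i : smooth_on Omega (fun y => f y * (2 * bend u i y)).
  by apply: (smoothM oO sf); exact: smoothM.
apply: (smoothD oO); last first.
  exact: (smoothN oO (smooth_sum oO (fun i => smooth_pderiv i (sb i)))).
exact: (smooth_sum oO (fun i => smooth_sum oO
  (fun j => smooth_pderiv j (smooth_pderiv i (sA i j))))).
Qed.

Lemma normal_adjointE f x : smooth_on Omega f -> Omega x ->
  normal_adjoint u f x = normal_operator u f x.
Proof.
move=> sf Ox; rewrite /normal_adjoint.
have cE : bend u = (fun j y => \sum_i pderiv i (normal_coord u j) y * normal_coord u i y).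
  by apply/funext => j; apply/funext => y; exact: bendE.
have := adjoint_identity oO sN sf Ox; rewrite /= -/(bend u) => H.
have {}H : normal_adjoint u f x = \sum_i \sum_j normal_coord u i x * normal_coord u j x *
    pderiv i (pderiv j f) x + 2 * (divergence (unit_normal u) x *
      \sum_i normal_coord u i x * pderiv i f x) +
    (\sum_i pderiv i (fun y => divergence (unit_normal u) y * normal_coord u i y) x -
     \sum_i pderiv i (bend u i) x) * f x.
  by rewrite /normal_adjoint cE; exact: H.
rewrite -/(normal_adjoint u f x) H /normal_operator frob_normal_proj.
congr (_ + 2 * _ + (_ - _) * _).
- apply: eq_bigr => i _; apply: eq_bigr => j _; congr (_ * _).
  by rewrite mxE.
- rewrite /dotv mulr_sumr; apply: eq_bigr => i _.
  have -> : grad f x 0 i = pderiv i f x by rewrite mxE.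
  have -> : (divergence (unit_normal u) x *: unit_normal u x) 0 i =
    divergence (unit_normal u) x * normal_coord u i x by rewrite mxE.
  by rewrite mulrA.
- rewrite [in RHS]/divergence; apply: eq_bigr => i _; congr (pderiv i _ x).
  by apply/funext => y; rewrite [RHS]mxE.
Qed.

Lemma willmore_adjoint w : test_function Omega w ->
  \int[leb]_(x in Omega) (2 * willmore_defect eps u x * willmore_variation u w eps x) =
  \int[leb]_(x in Omega) (2 * (eps * laplacian (willmore_defect eps u) x
     - eps^-1 * (derive1n 2 double_well (u x) * willmore_defect eps u x)) * w x).
Proof.
move=> tw; set a := willmore_defect eps u.
have scW : smooth_on Omega (fun x => - (2 * eps^-1) * (derive1n 2 double_well (u x) * a x)).
  by apply: smoothM => //; exact: smoothM.
have t1 i : test_function Omega (fun x => a x * pderiv i (pderiv i w) x).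
  exact: (testMl oO sa (test_pderiv i oO (test_pderiv i oO tw))).
have t2 i : test_function Omega (fun x => pderiv i (pderiv i a) x * w x).
  exact: (testMl oO (smooth_pderiv i (smooth_pderiv i sa)) tw).
have T1 := test_sum oO t1; have T2 := test_sum oO t2.
have T3 := testMl oO scW tw.
transitivity (2 * eps * \int[leb]_(x in Omega) (\sum_i a x * pderiv i (pderiv i w) x)
   + \int[leb]_(x in Omega) (- (2 * eps^-1) * (derive1n 2 double_well (u x) * a x) * w x)).
  rewrite -(test_integralZ (2 * eps) oO T1) -(test_integralD oO (testMl oO (sc (2 * eps)) T1) T3).
  apply: eq_Rintegral => x _; rewrite -mulr_sumr /willmore_variation -/(laplacian w x); ring.
rewrite (test_integral_sum oO t1) (eq_bigr _ (fun i _ => test_by_parts2 i i oO sa tw)).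
rewrite -(test_integral_sum oO t2) -(test_integralZ (2 * eps) oO T2).
rewrite -(test_integralD oO (testMl oO (sc (2 * eps)) T2) T3).
apply: eq_Rintegral => x _; rewrite -mulr_suml -/(laplacian a x); ring.
Qed.

Lemma profile_adjoint w : test_function Omega w ->
  \int[leb]_(x in Omega) (2 * profile_defect eps u x * profile_variation u w eps x) =
  \int[leb]_(x in Omega) (2 * eps * (normal_adjoint u (profile_defect eps u) x
     - (eps ^+ 2)^-1 * derive1n 2 double_well (u x) * profile_defect eps u x) * w x).
Proof.
move=> tw; set f := profile_defect eps u.
pose c x := - ((eps ^+ 2)^-1 * derive1n 2 double_well (u x) * f x).
have scc : smooth_on Omega c.
  apply: (@smooth_eq_on _ _ _ (fun x => (- (eps ^+ 2)^-1) * (derive1n 2 double_well (u x) * f x))) => //.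
    by move=> x _; rewrite /c; ring.
  by apply: smoothM => //; exact: smoothM.
have sA i j : smooth_on Omega (fun y => f y * (normal_coord u i y * normal_coord u j y)).
  by apply: smoothM => //; exact: smoothM.
have sb i : smooth_on Omega (fun y => f y * (2 * bend u i y)).
  by apply: smoothM => //; exact: smoothM.
have H := test_by_parts_operator oO sA sb scc tw.
have tL : test_function Omega (fun x => \sum_i \sum_j f x * (normal_coord u i x * normal_coord u j x) *
      pderiv i (pderiv j w) x + \sum_i f x * (2 * bend u i x) * pderiv i w x + c x * w x).
  exact: (testD oO (testD oO (test_sum oO (fun i => test_sum oO (fun j =>
    testMl oO (sA i j) (test_pderiv i oO (test_pderiv j oO tw)))))
    (test_sum oO (fun i => testMl oO (sb i) (test_pderiv i oO tw)))) (testMl oO scc tw)).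
have tR : test_function Omega (fun x => (normal_adjoint u f x + c x) * w x).
  apply: testMl => //; apply: smoothD => //; exact: smooth_normal_adjoint.
transitivity (2 * eps * \int[leb]_(x in Omega) (\sum_i \sum_j f x * (normal_coord u i x * normal_coord u j x) *
      pderiv i (pderiv j w) x + \sum_i f x * (2 * bend u i x) * pderiv i w x + c x * w x)).
  rewrite -(test_integralZ (2 * eps) oO tL); apply: eq_Rintegral => x _.
  have -> : \sum_i \sum_j f x * (normal_coord u i x * normal_coord u j x) *
      pderiv i (pderiv j w) x = f x * \sum_i \sum_j normal_coord u i x * normal_coord u j x *
      pderiv i (pderiv j w) x.
    rewrite mulr_sumr; apply: eq_bigr => i _; rewrite mulr_sumr; apply: eq_bigr => j _.
    by rewrite [RHS]mulrA.
  have -> : \sum_i f x * (2 * bend u i x) * pderiv i w x = f x * \sum_i 2 * bend u i x * pderiv i w x.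
    by rewrite mulr_sumr; apply: eq_bigr => i _; rewrite [RHS]mulrA.
  rewrite /profile_variation /c -/f.
  set A := \sum_i \sum_j _; set B := \sum_i _; move: A B => A B.
  move: (f x) (w x) (derive1n 2 double_well (u x)).
  by move=> a b d; field.
rewrite H -[X in _ * X]/(\int[leb]_(x in Omega) ((normal_adjoint u f x + c x) * w x)).
rewrite -(test_integralZ (2 * eps) oO tR); apply: eq_Rintegral => x _.
by rewrite /c mulrA.
Qed.

Lemma laplacian_potential x : Omega x ->
  laplacian (potential eps u) x = - eps * laplacian (willmore_defect eps u) x.
Proof.
move=> Ox; have -> : potential eps u = (fun x => - eps * willmore_defect eps u x).
  by apply/funext => y; rewrite /potential /willmore_defect; field.
rewrite /laplacian mulr_sumr; apply: eq_bigr => i _.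
have d y : Omega y -> differentiable (willmore_defect eps u) y by exact: smooth_differentiable.
rewrite (pderiv_eq_on i oO (g := fun y => - eps * pderiv i (willmore_defect eps u) y)) ?inE//.
  by rewrite pderivZ//; exact: (smooth_differentiable (smooth_pderiv i sa) Ox).
by move=> y; rewrite inE => Oy; rewrite pderivZ//; exact: d.
Qed.

Lemma powR_penalty : eps `^ (1 - alpha) = eps ^+ 2 * (eps `^ (1 + alpha))^-1.
Proof.
have P0 : eps `^ (1 + alpha) != 0 by rewrite lt0r_neq0// powR_gt0.
apply: (mulIf P0); rewrite mulfVK// -powRD; last by rewrite eps0 implybT.
by rewrite (_ : 1 - alpha + (1 + alpha) = 2%:R) ?powR_mulrn ?ltW//; ring.
Qed.

(** The gradient in the form given by the two adjoints; on Omega it is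
    [err_gradient]. *)
Definition gradient_on x : R :=
  (2 * eps)^-1 * (2 * (eps * laplacian (willmore_defect eps u) x
     - eps^-1 * (derive1n 2 double_well (u x) * willmore_defect eps u x)))
  + beta * (eps `^ (1 + alpha))^-1 * (2 * eps * (normal_adjoint u (profile_defect eps u) x
     - (eps ^+ 2)^-1 * derive1n 2 double_well (u x) * profile_defect eps u x)).

Lemma err_gradientE x : Omega x -> gradient_on x = err_gradient eps alpha beta u x.
Proof.
move=> Ox; rewrite /gradient_on /err_gradient /flow_speed /penalty.
rewrite laplacian_potential// normal_adjointE// powR_penalty.
have -> : potential eps u x = - eps * willmore_defect eps u x.
  by rewrite /potential /willmore_defect; field.
have P0 : eps `^ (1 + alpha) != 0 by rewrite lt0r_neq0// powR_gt0.
move: (eps `^ (1 + alpha)) P0 (normal_operator _ _ _) => P P0 A.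
move: (laplacian _ x) (willmore_defect _ _ x) (profile_defect _ _ x) (derive1n _ _ _).
by move=> a b c d; field; rewrite P0 eps0.
Qed.

Let s1 : smooth_on Omega (fun x => 2 * (eps * laplacian (willmore_defect eps u) x
     - eps^-1 * (derive1n 2 double_well (u x) * willmore_defect eps u x))).
Proof.
apply: smoothM => //.
apply: (@smooth_eq_on _ _ _ (fun x => eps * laplacian (willmore_defect eps u) x
     + (- eps^-1) * (derive1n 2 double_well (u x) * willmore_defect eps u x))) => //.
  by move=> x _; rewrite mulNr.
by apply: smoothD => //; apply: smoothM => //; [exact: smooth_laplacian|exact: smoothM].
Qed.

Let s2 : smooth_on Omega (fun x => 2 * eps * (normal_adjoint u (profile_defect eps u) x
     - (eps ^+ 2)^-1 * derive1n 2 double_well (u x) * profile_defect eps u x)).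
Proof.
apply: smoothM => //.
apply: (@smooth_eq_on _ _ _ (fun x => normal_adjoint u (profile_defect eps u) x
     + (- (eps ^+ 2)^-1) * (derive1n 2 double_well (u x) * profile_defect eps u x))) => //.
  by move=> x _; rewrite mulNr mulrA.
apply: smoothD => //; first exact: smooth_normal_adjoint.
by apply: smoothM => //; exact: smoothM.
Qed.

Lemma smooth_gradient_on : smooth_on Omega gradient_on.
Proof. by apply: smoothD => //; exact: smoothM. Qed.

Lemma smooth_err_gradient : smooth_on Omega (err_gradient eps alpha beta u).
Proof.
apply: smooth_eq_on smooth_gradient_on => // x; rewrite inE; exact: err_gradientE.
Qed.

Hypothesis bO : bounded_set Omega.
Hypothesis fin : finite_err_energy Omega eps u.

Lemma is_L2_gradient_err :
  is_L2_gradient Omega (err_energy Omega eps alpha beta) u (err_gradient eps alpha beta u).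
Proof.
move=> w tw.
have t1 := testMl oO s1 tw; have t2 := testMl oO s2 tw.
split; first exact: (test_integrable mO (testMl oO smooth_err_gradient tw)).
have -> : \int[leb]_(x in Omega) (err_gradient eps alpha beta u x * w x) =
    (2 * eps)^-1 * \int[leb]_(x in Omega) (2 * willmore_defect eps u x * willmore_variation u w eps x)
    + beta * (eps `^ (1 + alpha))^-1 *
      \int[leb]_(x in Omega) (2 * profile_defect eps u x * profile_variation u w eps x).
  rewrite (willmore_adjoint tw) (profile_adjoint tw).
  rewrite -(test_integralZ _ oO t1) -(test_integralZ _ oO t2).
  rewrite -(test_integralD oO (testMl oO (sc _) t1) (testMl oO (sc _) t2)).
  apply: eq_Rintegral => x; rewrite inE => Ox.
  by rewrite -err_gradientE// /gradient_on mulrDl !mulrA.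
have cw := willmore_cvg oO bO su tw fin.
have cp := profile_cvg oO bO su gu tw fin.
pose W s := \int[leb]_(x in Omega) (willmore_defect eps (fun y => u y + s * w y) x ^+ 2).
pose P s := \int[leb]_(x in Omega) (profile_defect eps (fun y => u y + s * w y) x ^+ 2).
pose W0 := \int[leb]_(x in Omega) (willmore_defect eps u x ^+ 2).
pose P0 := \int[leb]_(x in Omega) (profile_defect eps u x ^+ 2).
pose c1 := (2 * eps)^-1; pose c2 := beta * (eps `^ (1 + alpha))^-1.
have E : (fun s => (err_energy Omega eps alpha beta (fun x => u x + s * w x) -
    err_energy Omega eps alpha beta u) / s) =
  (fun s => c1 * ((W s - W0) / s) + c2 * ((P s - P0) / s)).
  apply/funext => s; rewrite /err_energy -/(W s) -/(P s) -/W0 -/P0 -/c1 -/c2; ring.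
rewrite E.
have k1 : (fun=> c1) x @[x --> (0 : R)^'] --> c1 by exact: cvg_cst.
have k2 : (fun=> c2) x @[x --> (0 : R)^'] --> c2 by exact: cvg_cst.
exact: (cvgD (cvgM k1 cw) (cvgM k2 cp)).
Qed.

End err_gradient.

(** * The flow and the system *)

Section flow_and_system.

Context {R : realType} {n : nat}.
Local Notation E := 'rV[R]_n.
Local Notation leb := (lebesgue_row n).

(** The two limits of the difference quotient coincide, so the difference of the
    two gradients is orthogonal to all test functions. *)
Lemma L2_gradient_unique (Omega : set E) (F : (E -> R) -> R) (u g h : E -> R) :
  open Omega -> (forall x, Omega x -> {for x, continuous g}) ->
  (forall x, Omega x -> {for x, continuous h}) ->
  is_L2_gradient Omega F u g -> is_L2_gradient Omega F u h ->
  forall x, Omega x -> g x = h x.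
Proof.
move=> oO cg ch Hg Hh x Ox; apply/eqP; rewrite -subr_eq0; apply/eqP.
have mO := row_open_measurable oO.
apply: (@test_integral_eq0 _ _ Omega (fun y => g y - h y) x) => //.
  by move=> y Oy; exact: (continuousB (cg y Oy) (ch y Oy)).
move=> w tw; have [ig lg] := Hg w tw; have [ih lh] := Hh w tw.
have -> : (fun y => (g y - h y) * w y) = (fun y => g y * w y - h y * w y).
  by apply/funext => y; rewrite mulrBl.
split; first exact: (integrableB mO ig ih).
rewrite RintegralB//; apply/eqP; rewrite subr_eq0; apply/eqP.
exact: (cvg_unique _ lg lh).
Qed.

Lemma is_L2_gradient_eq_on (Omega : set E) (F : (E -> R) -> R) (u g h : E -> R) :
  {in Omega, g =1 h} -> open Omega -> is_L2_gradient Omega F u g -> is_L2_gradient Omega F u h.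
Proof.
move=> gh oO Hg w tw; have [ig lg] := Hg w tw; split.
  apply: eq_integrable ig; first exact: row_open_measurable.
  by move=> x xO /=; rewrite gh.
have -> : \int[leb]_(x in Omega) (h x * w x) = \int[leb]_(x in Omega) (g x * w x).
  by apply: eq_Rintegral => x xO; rewrite gh.
exact: lg.
Qed.

(** An L2-gradient realizing the flow equals -eps times the time derivative on
    Omega, which is continuous; so it is the explicit gradient, pointwise. *)
Lemma flow_speedP (Omega : set E) (F : (E -> R) -> R) eps alpha beta (I : set R)
    (u : R -> E -> R) :
  open Omega -> 0 < eps ->
  (forall t x, I t -> Omega x -> {for x, continuous (dt u t)}) ->
  (forall t, I t -> smooth_on Omega (err_gradient eps alpha beta (u t))) ->
  (forall t, I t -> is_L2_gradient Omega F (u t) (err_gradient eps alpha beta (u t))) ->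
  L2_gradient_flow Omega F eps I u <->
  forall t x, I t -> Omega x -> eps ^+ 2 * dt u t x = flow_speed eps alpha beta (u t) x.
Proof.
move=> oO eps_gt0 cdt sG HG; have eps0 := lt0r_neq0 eps_gt0; split.
  move=> flow t x It Ox; have [g Hg gE] := flow t It.
  have gE' : {in Omega, g =1 (fun y => - eps * dt u t y)}.
    by move=> y; rewrite inE => Oy; rewrite gE//; field.
  have := @L2_gradient_unique Omega F (u t) (fun y => - eps * dt u t y)
    (err_gradient eps alpha beta (u t)) oO.
  move=> /(_ _ _ (is_L2_gradient_eq_on gE' oO Hg) (HG t It) x Ox) U.
  have {}U : - eps * dt u t x = err_gradient eps alpha beta (u t) x.
    apply: U => y Oy; last exact: (smooth_continuous (sG t It) Oy).
    have cc : {for y, continuous (fun=> - eps : R)} by exact: cst_continuous.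
    exact: (continuousM cc (cdt t y It Oy)).
  have -> : eps ^+ 2 * dt u t x = - eps * (- eps * dt u t x) by ring.
  by rewrite U /err_gradient; field.
move=> H t It; exists (err_gradient eps alpha beta (u t)); first exact: HG.
move=> x Ox; have -> : dt u t x = (eps ^+ 2)^-1 * (eps ^+ 2 * dt u t x) by field.
by rewrite H// /err_gradient; field.
Qed.

Lemma hess_eq_on (Omega : set E) (f g : E -> R) x : open Omega ->
  {in Omega, f =1 g} -> Omega x -> hess f x = hess g x.
Proof.
move=> oO fg Ox; apply/matrixP => i j; rewrite [LHS]mxE [RHS]mxE.
exact: (pderiv_eq_on i oO (pderiv_eq_on j oO fg) (mem_set Ox)).
Qed.

Lemma grad_eq_on (Omega : set E) (f g : E -> R) x : open Omega ->
  {in Omega, f =1 g} -> Omega x -> grad f x = grad g x.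
Proof.
move=> oO fg Ox; apply/rowP => i; rewrite [LHS]mxE [RHS]mxE.
exact: (pderiv_eq_on i oO fg (mem_set Ox)).
Qed.

Lemma laplacian_eq_on (Omega : set E) (f g : E -> R) x : open Omega ->
  {in Omega, f =1 g} -> Omega x -> laplacian f x = laplacian g x.
Proof.
move=> oO fg Ox; rewrite /laplacian; apply: eq_bigr => i _.
by apply: (pderiv_eq_on i oO (pderiv_eq_on i oO fg)); rewrite inE.
Qed.

(** The equations of the system determine mu, xi, L and B on Omega, and only their
    values on the open set Omega enter their derivatives there. *)
Lemma err_systemP (Omega : set E) eps alpha beta (I : set R) (u : R -> E -> R) :
  open Omega ->
  (exists mu xi L B : R -> E -> R, err_system Omega eps alpha beta I u mu xi L B) <->
  forall t x, I t -> Omega x -> eps ^+ 2 * dt u t x = flow_speed eps alpha beta (u t) x.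
Proof.
move=> oO; split.
  move=> [mu [xi [L [B [ev muE xiE LE BE]]]]] t x It Ox.
  have mu_on : {in Omega, mu t =1 potential eps (u t)}.
    by move=> y; rewrite inE => Oy; exact: muE.
  have xi_on : {in Omega, xi t =1 profile_defect eps (u t)}.
    by move=> y; rewrite inE => Oy; exact: xiE.
  rewrite (ev t x It Ox) /flow_speed (laplacian_eq_on oO mu_on Ox).
  rewrite (mu_on x (mem_set Ox)); congr (_ - _ - beta * _).
  rewrite (LE t x It Ox) (BE t x It Ox) (hess_eq_on oO xi_on Ox) (grad_eq_on oO xi_on Ox).
  rewrite (xi_on x (mem_set Ox)) /penalty /normal_operator; congr (_ * _); ring.
move=> H; exists (fun t => potential eps (u t)), (fun t => profile_defect eps (u t)),
  (fun t => penalty eps alpha (u t)),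
  (fun t x => divergence (fun y => divergence (unit_normal (u t)) y *: unit_normal (u t) y) x
     - divergence (fun y => mxvmul (nabla (unit_normal (u t)) y) (unit_normal (u t) y)) x).
split => // t x It Ox.
by rewrite /penalty /normal_operator; congr (_ * _); ring.
Qed.

End flow_and_system.

Theorem proposition3p9 (R : realType) (N : nat) (Omega : set 'rV[R]_N)
    (eps alpha beta : R) (I : set R) (u : R -> 'rV[R]_N -> R)
    (Omega_open : open Omega)
    (Omega_bounded : bounded_set Omega)
    (Omega_lipschitz : lipschitz_boundary Omega)
    (eps_gt0 : 0 < eps) (alpha_ge0 : 0 <= alpha)
    (u_smooth : forall t, I t -> smooth_on Omega (u t))
    (u_time : forall t x, I t -> Omega x -> derivable (fun s => u s x) t 1)
    (dtu_continuous : forall t x, I t -> Omega x -> {for x, continuous (dt u t)})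
    (grad_neq0 : forall t x, I t -> Omega x -> grad (u t) x != 0)
    (u_energy : forall t, I t -> finite_err_energy Omega eps (u t)) :
  L2_gradient_flow Omega (err_energy Omega eps alpha beta) eps I u <->
  exists mu xi L B : R -> 'rV[R]_N -> R,
    err_system Omega eps alpha beta I u mu xi L B.
Proof.
apply: (iff_trans _ (iff_sym (err_systemP eps alpha beta I u Omega_open))).
apply: flow_speedP => // t It.
- exact: (smooth_err_gradient alpha beta Omega_open (u_smooth t It) (fun x => grad_neq0 t x It) eps_gt0).
- exact: (is_L2_gradient_err alpha beta Omega_open (u_smooth t It) (fun x => grad_neq0 t x It)
    eps_gt0 Omega_bounded (u_energy t It)).
Qed.
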